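(* Let $p$ be a prime and $G$ a transitive permutation group of degree $p^2$ whose point stabilizers are dihedral groups $D_{2n}$ of order $2n$ ($n\ge 2$). Then $G$ is isomorphic to one of the following groups (all subgroups of $AGL(2,p)$, $T$ the translation group): (1) $p=2$, $n=3$, $G_1=T\rtimes\langle x,y\rangle\cong S_4$ with $x=\|1,1;1,0\|$, $y=\|0,1;1,0\|$; (2) $p\ge3$, $n\mid(p+1)$, $n\ge3$, $G_2=T\rtimes\langle x,y\rangle$ with $x=\|e,f\theta;f,e\|$ of order $n$, where $e,f\in\mathbb{F}_p$, $e^2-f^2\theta=1$, and $y=\|1,0;0,-1\|$; (3) $p\ge3$, $n\mid(p-1)$, $n\ge3$, $G_3=T\rtimes\langle x,y\rangle$ with $x=\|t,0;0,t^{-1}\|$, $t\in\mathbb{F}_p^*$ of order $n$, and $y=\|0,1;1,0\|$; (4) $p\ge3$, $n=2$, $G_4=T\rtimes\langle x,y\rangle$ with $x=\|-1,0;0,-1\|$, $y=\|1,0;0,-1\|$; (5) $p\ge3$, $n=p$, $G_5=T\rtimes\langle x,y\rangle$ with $x=\|1,1;0,1\|$, $y=\|-1,0;0,1\|$; (6) $p\ge3$, $n=2p$, $G_6=T\rtimes\langle x_1,x_2,y\rangle$ with $x_1=\|1,1;0,1\|$, $x_2=\|-1,0;0,-1\|$, $y=\|1,0;0,-1\|$; (7) $p\ge3$, $n=p$, $G_7=T\rtimes\langle x,y\rangle$ with $x=\|1,1;0,1\|$, $y=\|-1,0;0,-1\|$.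
   Context: $D_{2n}$ denotes the dihedral group of order $2n$ (so $D_4\cong\mathbb{Z}_2^2$). $\mathbb{F}_p^*=\langle\theta\rangle$ (a fixed generator). $\|a,b;c,d\|$ denotes the $2\times2$ matrix over $\mathbb{F}_p$ with rows $(a,b)$ and $(c,d)$. $V=\mathbb{F}_p^2$ consists of row vectors, $GL(2,p)$ acts on $V$ on the right, $t_a$ ($a\in V$) is the translation $v\mapsto v+a$, $T=\{t_a: a\in V\}\cong\mathbb{Z}_p^2$, and $AGL(2,p)=T\rtimes GL(2,p)$ with $g^{-1}t_ag=t_{ag}$. For $L\le GL(2,p)$, $T\rtimes L$ is the subgroup of $AGL(2,p)$ generated by $T$ and $L$, acting on $V$ (degree $p^2$). *)

(* Defs.v *)
From HB Require Import structures.
From mathcomp Require Import all_boot all_order all_algebra all_fingroup all_solvable.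
Set Implicit Arguments. Unset Strict Implicit. Unset Printing Implicit Defensive.
Import GRing.Theory.
Local Open Scope ring_scope.

(* V = F_p^2 as row vectors 'rV['F_p]_2 ; GL(2,p) acts on the right. *)

Definition mx2 (R : Type) (a b c d : R) : 'M[R]_2 :=
  \matrix_(i < 2, j < 2)
    if i == 0 :> nat then (if j == 0 :> nat then a else b)
    else (if j == 0 :> nat then c else d).

Arguments mx2 {R} (a b c d)%_R.

Section Affine.
Variable p : nat.
Local Notation F := 'F_p.
Local Notation V := 'rV[F]_2.

Definition trans_perm (a : V) : {perm V} := perm (addIr a).

(* the linear map v |-> v A, as a permutation of V (identity if A is singular) *)
Definition lin_perm (A : 'M[F]_2) : {perm V} :=
  match A \in unitmx as b return (A \in unitmx = b -> {perm V}) with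
  | true => fun h => perm (can_inj (mulmxK h))
  | false => fun _ => 1%g
  end erefl.

Definition transl_grp : {set {perm V}} := [set trans_perm a | a : V].

Definition affine_gen (L : seq 'M[F]_2) : {set {perm V}} :=
  <<transl_grp :|: [set lin_perm A | A in L]>>%g.
End Affine.

Definition has_order (R : nzRingType) (a : R) (n : nat) : Prop :=
  (0 < n)%N /\ a ^+ n = 1 /\ forall k : nat, (0 < k < n)%N -> a ^+ k != 1.
Arguments affine_gen : clear implicits.

(* Main.v *)
Require Import Defs.
From HB Require Import structures.
From mathcomp Require Import all_boot all_order all_algebra all_fingroup all_solvable.
From mathcomp Require Import all_field all_character ring.
Import GRing.Theory.

(** If [H] is a point stabiliser then [H] has prime power index and a cyclic
    subgroup of index 2.  For odd [p] this makes [G] solvable: in a simple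
    counterexample either [H] has a nontrivial central element, whose class has
    prime power size, contradicting Burnside, or the order of [G] is twice an odd
    number.  As [H] is core-free, ['O_p^'(G) = 1], so [Q = 'O_p(G)] contains its
    centraliser.  If [p] does not divide [n], then [Q] is a regular Sylow subgroup.
    Otherwise a Sylow subgroup [P] has order [p ^ 3]; it is normal because the
    [p] conjugates of [D = 'O_p(H)] miss exactly one line of a hypothetical [Q] of
    order [p ^ 2], and Gaschutz' theorem in [G / 'Z(P)] yields a normal subgroup [T]
    of order [p ^ 2] avoiding [D].  In all cases [G = T ><| H] with [T] elementary
    abelian and [H] faithful on [T], so it remains to classify dihedral subgroups of
    [GL(2, p)].  For [n > 2], in an eigenbasis of the reflection [y] the rotation [x]
    has the form [mx2 a b c a] with [a ^ 2 - b c = 1], and the cases are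
    distinguished by whether [b c] is zero, a nonzero square or a nonsquare. *)

Set Implicit Arguments. Unset Strict Implicit. Unset Printing Implicit Defensive.
Local Open Scope group_scope.

(** * Solvability *)

(* Elements of order 2 act in the regular representation as products of [k]
   transpositions, so the even elements form a normal subgroup of index 2. *)
Lemma not_simple_double_odd (gT : finGroupType) (G : {group gT}) (k : nat) :
  #|G| = (2 * k)%N -> odd k -> 1 < k -> ~~ simple G.
Proof.
move=> oG odd_k k_gt1; rewrite (isog_simple (isog_subg G)).
rewrite (card_isog (isog_subg G)) cardsT in oG.
(* Replacing [G] by a full group type makes the regular representation act on exactly [2 * k]
   points. *)
suff main (hT : finGroupType) : #|hT| = (2 * k)%N -> ~~ simple [set: hT].
  exact: main oG.
move: hT => {gT G oG}gT ogT.
apply/negP=> /simpleP[_ simG].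
pose f := [morphism of actperm 'R%act : gT -> {perm gT}].
have fM x y : f (x * y) = f x * f y by rewrite morphM ?inE.
pose N := (f @*^-1 'Alt_gT)%G.
have memN x : (x \in N) = ~~ odd_perm (f x).
  by rewrite -Alt_even; apply/morphpreP/idP=> [[] //|]; rewrite in_setT.
have [|t _ ot] := @Cauchy _ 2 [set: gT] isT; first by rewrite cardsT ogT dvdn_mulr.
(* The sign is the parity of the number of points plus the number of cycles; [f t] has [k] cycles of
   length 2 on [2 * k] points, and [k] is odd. *)
have t_odd : odd_perm (f t).
  rewrite /odd_perm ogT oddM /=.
  suff -> : #|porbits (f t)| = k by rewrite odd_k.
  have orb x : #|porbit (f t) x| = 2.
    rewrite porbit_actperm ?inE // orbitR card_lcoset. exact: ot.
  have := @card_uniform_partition _ 2 (porbits (f t)) [set: gT].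
  rewrite cardsT ogT => /(_ _ _)/eqP; rewrite mulnC eqn_pmul2r // => H.
  apply/esym/eqP/H.
  - by move=> A /imsetP[x _ ->].
  - have -> : porbits (f t) = orbit 'P <[f t]> @: [set: gT].
      by apply/setP=> A; apply/imsetP/imsetP=> -[x _ ->]; exists x; rewrite ?inE // porbitE.
    by apply: orbit_partition; apply/actsP=> a _ x; rewrite !inE.
have [|N1|NT] := simG N.
- rewrite /normal subsetT; apply/subsetP=> x _; rewrite inE.
  apply/subsetP=> _ /imsetP[y Ny ->].
  by rewrite memN morphJ ?in_setT // odd_permJ -memN.
(* If [N] is trivial, every nontrivial [s] is odd, so [s * t] is even, hence 1, and [s] is the
   involution [t]. *)
- suff : #|gT| <= 2 by rewrite ogT -{2}[2]muln1 leq_mul2l /= leqNgt k_gt1.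
  rewrite -cardsT; apply: leq_trans (_ : #|[set 1; t]| <= 2).
    apply/subset_leq_card/subsetP=> s _; rewrite !inE.
    case: eqVneq => //= s1.
    have s_odd : odd_perm (f s).
      by apply: contraR s1; rewrite -memN N1 inE.
    have : s * t \in N by rewrite memN fM odd_permM s_odd t_odd.
    rewrite N1 inE -eq_invg_mul => /eqP ts.
    have tV : t^-1 = t by rewrite invg_expg ot expg1.
    by rewrite -tV -ts invgK.
  by rewrite cards2; case: (_ != _).
- by have := memN t; rewrite NT t_odd inE.
Qed.

(** The index on the left is that of [H] in the subgroup [N * H] of [G]. *)
Lemma index_normalI_dvd (gT : finGroupType) (G H N : {group gT}) :
  H \subset G -> N <| G -> #|N : N :&: H| %| #|G : H|.
Proof.
move=> sHG /andP[sNG nNG]; rewrite indexgI.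
rewrite -(dvdn_pmul2r (cardG_gt0 H)) LagrangeMr [X in _ %| X]mulnC Lagrange //.
by rewrite -norm_joinEr ?(subset_trans sHG) // cardSg // join_subG sNG.
Qed.

(** Induction on the order of [G]. Asking only for a cyclic [C] of index dividing 2, and not for a
    dihedral [H], lets the hypotheses pass to [N] and [G / N], so only simple groups remain. *)
Lemma solvable_pnat_index (p : nat) (gT : finGroupType) (G H C : {group gT}) :
    prime p -> odd p -> H \subset G -> p.-nat #|G : H| ->
    C <| H -> cyclic C -> #|H : C| %| 2 ->
  solvable G.
Proof.
move=> p_pr odd_p.
move: {2}_.+1 (ltnSn #|G|) => m; elim: m => // m IHm in gT G H C *.
rewrite ltnS => leGm sHG pGH nsCH cycC oHC.
have [simG | ] := boolP (simple G); last first.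
  rewrite negb_forall_in => /exists_inP[N sNG]; rewrite eq_sym.
  have [->|] := eqVneq N G.
    rewrite groupP /= genGid normG andbT eqb_id negbK => /eqP->.
    exact: solvable1.
  rewrite [N == G]eqEproper sNG eqbF_neg !negbK => ltNG /and3P[grN].
  case/isgroupP: grN => {}N -> in sNG ltNG *; rewrite /= genGid => ntN nNG.
  have nsNG: N <| G by apply/andP.
  have nNH := subset_trans sHG nNG.
  have [sCH nCH] := andP nsCH.
  have defNC : N :&: C = (N :&: H) :&: C by rewrite -setIA (setIidPr sCH).
  rewrite (series_sol nsNG); apply/andP; split.
    apply: (IHm _ N (N :&: H)%G (N :&: C)%G).
    - by apply: leq_trans leGm; apply: proper_card.
    - exact: subsetIl.
    - exact: pnat_dvd (index_normalI_dvd sHG nsNG) pGH.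
    - by rewrite /= defNC (normalGI _ nsCH) ?subsetIr.
    - exact: cyclicS (subsetIr _ _) cycC.
    apply: dvdn_trans oHC; rewrite /= defNC; apply: index_normalI_dvd => //.
    by rewrite /= setIC (normalGI sHG).
  apply: (IHm _ (G / N)%G (H / N)%G (C / N)%G).
  - by apply: leq_trans leGm; apply: ltn_quotient.
  - exact: quotientS.
  - by apply: pnat_dvd pGH; rewrite index_quotient // subIset ?nNG.
  - exact: quotient_normal.
  - exact: quotient_cyclic.
  - by apply: dvdn_trans oHC; rewrite index_quotient // subIset ?nNH.
have [cGG | ncGG] := boolP (abelian G); first exact: abelian_sol.
(* The class of [z] has length dividing the [p]-power [#|G : H|], while by Burnside a nontrivial
   class of a nonabelian simple group has a length with at least two prime divisors. *)
have no_central z : z \in H -> H \subset 'C[z] -> z = 1.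
  move=> Hz cHz; apply: contraNeq ncGG => nt_z.
  have : size (primes #|z ^: G|) <= 1.
    rewrite -index_cent1.
    have : p.-nat #|G : 'C_G[z]|.
      by apply: pnat_dvd pGH; rewrite indexgS // subsetI sHG.
    case/p_natP=> // j ->; case: j => [|j] //.
    by rewrite primesX // primes_prime.
  rewrite leqNgt; apply: contraR => /(primes_class_simple_gt1 simG)-> //.
  by rewrite !inE classG_eq1 nt_z mem_classes // (subsetP sHG).
have [sCH nCH] := andP nsCH.
(* For odd [#|H|] the group [H = C] is abelian, so [no_central] makes it trivial and [G] is a
   [p]-group. *)
have [odd_H | even_H] := boolP (odd #|H|).
  have /eqP/index1g-/(_ sCH) eqCH : #|H : C| == 1%N.
    rewrite -dvdn1 -(@Gauss_dvdr _ 2) ?muln1 //.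
    by rewrite coprime_sym coprime2n (dvdn_odd (dvdn_indexg _ _)).
  have H1 : H :=: 1.
    apply/trivgP/subsetP=> z Hz; rewrite inE (no_central z) //.
    by rewrite -eqCH sub_cent1; apply: (subsetP (cyclic_abelian cycC)); rewrite eqCH.
  rewrite H1 indexg1 in pGH; exact: pgroup_sol pGH.
(* A subgroup of order 2 is characteristic in the cyclic group [C], hence normal in [H], and so its
   generator is central in [H]. *)
have [odd_C | even_C] := boolP (odd #|C|); last first.
  have [|z Cz oz] := @Cauchy _ 2 C isT; first by rewrite dvdn2.
  suff z1 : z = 1 by rewrite z1 order1 in oz.
  apply: no_central; first exact: (subsetP sCH).
  have nzH : <[z]> <| H by apply: char_normal_trans nsCH; rewrite sub_cyclic_char // cycle_subG.
  apply/subsetP=> h Hh; apply/cent1P/commute_sym/commgP/conjg_fixP.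
  have : z ^ h \in <[z]> by rewrite memJ_norm ?cycle_id // (subsetP (normal_norm nzH)).
  rewrite cycle2g // !inE conjg_eq1 -order_eq1 oz /=; by move/eqP.
have oH : #|H : C| = 2.
  move: oHC even_H; rewrite dvdn_divisors // -(Lagrange sCH) oddM odd_C /= !inE.
  by case/orP=> /eqP-> //.
have odd_GH : odd #|G : H| by case/p_natP: pGH => // j ->; rewrite oddX odd_p orbT.
have oG : #|G| = (2 * (#|C| * #|G : H|))%N.
  by rewrite -(Lagrange sHG) -(Lagrange sCH) oH [(_ * 2)%N]mulnC mulnA.
have [k_gt1 | ] := ltnP 1 (#|C| * #|G : H|)%N.
  have := not_simple_double_odd oG _ k_gt1.
  by rewrite simG oddM odd_C odd_GH => /(_ isT).
move=> k_le1; case/negP: ncGG; apply: cyclic_abelian; apply: prime_cyclic.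
rewrite oG; move: k_le1 (muln_gt0 #|C| #|G : H|); rewrite cardG_gt0 indexg_gt0.
by case: (_ * _)%N => [|[]].
Qed.

(** * A normal complement of the point stabiliser *)

(** The preimage [M] of ['F(G / 'F(G))] is a central extension of a nilpotent group, hence nilpotent
    and contained in ['F(G)]. So [G / 'F(G)] is solvable with trivial Fitting subgroup. *)
Lemma solvable_central_Fitting (gT : finGroupType) (G : {group gT}) :
  solvable G -> 'F(G) \subset 'Z(G) -> G \subset 'F(G).
Proof.
move=> solG cFG; rewrite -quotient_sub1 ?gFnorm //=.
rewrite subG1 -trivg_Fitting ?quotient_sol // -subG1.
have [M defM sFM nsMG] := inv_quotientN (Fitting_normal G) (Fitting_normal (G / 'F(G))).
have sMG := normal_sub nsMG.
have nFM : M \subset 'N('F(G)) by rewrite (subset_trans sMG) ?gFnorm.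
rewrite defM quotient_sub1 //; apply: (Fitting_max nsMG).
rewrite -quotient_center_nil.
have cFM : 'F(G) \subset 'Z(M).
  rewrite subsetI sFM (subset_trans cFG) // centsC (subset_trans sMG) //.
  by rewrite centsC subsetIr.
have nsFM : 'F(G) <| M := normalS sFM sMG (Fitting_normal G).
rewrite -(isog_nil (third_isog cFM nsFM (center_normal M))) quotient_nil //.
by rewrite /= -defM Fitting_nil.
Qed.

(** The centraliser [C] inherits ['O_p^'(C) = 1], so ['F(C) = 'O_p(C)]; this lies in ['O_p(G)] and
    is therefore central in [C], and the previous lemma applies to [C]. *)
Lemma cent_pcore_sub (p : nat) (gT : finGroupType) (G : {group gT}) :
  solvable G -> 'O_p^'(G) = 1 -> 'C_G('O_p(G)) \subset 'O_p(G).
Proof.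
move=> solG Op'1; set C := 'C_G('O_p(G))%G.
have nsCG : C <| G.
  rewrite /C /=; have := subcent_normal G 'O_p(G).
  by rewrite (setIidPl (gFnorm _ _)).
have solC : solvable C by apply: solvableS solG; apply: normal_sub.
have Op'C : 'O_p^'(C) = 1.
  by apply/trivgP; rewrite -Op'1 pcore_max ?pcore_pgroup ?gFnormal_trans.
have FC := Fitting_eq_pcore Op'C.
have sOC : 'O_p(C) \subset 'O_p(G) by rewrite pcore_max ?pcore_pgroup ?gFnormal_trans.
apply: subset_trans sOC; rewrite -FC; apply: solvable_central_Fitting => //.
rewrite subsetI Fitting_sub FC centsC (subset_trans (subsetIr _ _)) //.
by rewrite centS // pcore_max ?pcore_pgroup ?gFnormal_trans.
Qed.

(** The product of [r - 1] and [r + 1] is divisible by [p ^ k], and an odd prime divides at most one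
    of two numbers that differ by 2. *)
Lemma sqr_eq1_modX (p k r : nat) :
  prime p -> odd p -> r * r = 1 %[mod p ^ k] -> (p ^ k %| r.-1) || (p ^ k %| r.+1).
Proof.
move=> p_pr odd_p /eqP; case: r => [|r]; first by rewrite dvdn0.
rewrite eqn_mod_dvd // mulSn mulnS addSn subSS subn0 -[X in _ + _ * X]addn0.
rewrite (_ : r + (r + r * (r + 0)) = r * r.+2)%N; last by rewrite addn0 !mulnS.
have [p_r | p'r] := boolP (p %| r).
  rewrite mulnC Gauss_dvdr => [-> //|].
  rewrite coprimeXl // prime_coprime // -addn2 dvdn_addr // dvdn_divisors //.
  by rewrite !inE; apply/negP=> /orP[] /eqP E; rewrite E in p_pr odd_p.
by rewrite Gauss_dvdr ?coprimeXl ?prime_coprime // => ->; rewrite orbT.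
Qed.

(** Conjugation by [y] is [t |-> t ^+ r] with [r * r = 1] modulo [#[t]]; the only alternative to
    [r = -1] is [r = 1], which would centralise [T]. *)
Lemma involution_inverts_cyclic (p : nat) (gT : finGroupType) (T : {group gT}) (y : gT) :
    prime p -> odd p -> p.-group T -> cyclic T ->
    y \in 'N(T) -> y ^+ 2 = 1 -> y \notin 'C(T) ->
  {in T, forall t, t ^ y = t^-1}.
Proof.
move=> p_pr odd_p pT /cyclicP[t defT] nTy y2 ncTy.
have [k ot] : {k | #[t] = (p ^ k)%N}.
  have : p.-nat #[t] by rewrite orderE -defT.
  by case/p_natP=> // k ->; exists k.
have [r tr] : exists r, t ^ y = t ^+ r.
  by apply/cycleP; rewrite -defT memJ_norm // defT cycle_id.
have tk : t ^+ (r * r) = t.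
  by rewrite expgM -tr -conjXg -tr -conjgM -expg2 y2 conjg1.
have ty_id : t ^ y != t.
  apply: contra ncTy => /eqP ty; rewrite defT cent_cycle.
  by apply/cent1P/commute_sym/commgP/conjg_fixP.
have tyV : t ^ y = t^-1.
  have : r * r = 1 %[mod p ^ k].
    by apply/eqP; rewrite -ot -eq_expg_mod_order tk expg1.
  case/(sqr_eq1_modX p_pr odd_p)/orP=> [|]; rewrite -ot order_dvdn => /eqP E.
    case: r => [|r] in tr tk E *; first by rewrite tr -{2}tk invg1.
    by case/eqP: ty_id; rewrite tr expgS E mulg1.
  by rewrite tr; apply/eqP; rewrite eq_sym eq_invg_mul -expgS E.
by move=> u; rewrite defT => /cycleP[i ->]; rewrite conjXg tyV expgVn.
Qed.

Lemma abelem_card_p2 (p : nat) (gT : finGroupType) (T : {group gT}) :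
  prime p -> #|T| = (p ^ 2)%N -> ~~ cyclic T -> p.-abelem T.
Proof.
move=> p_pr oT ncT; have cTT := card_p2group_abelian p_pr oT.
rewrite /abelem /pgroup oT pnatX pnat_id // cTT /=.
apply/exponentP=> t Tt; apply/eqP; rewrite -order_dvdn.
have : #[t] %| p ^ 2 by rewrite -oT order_dvdG.
case/dvdn_pfactor=> // j le_j2 ot; rewrite ot; move: le_j2 ot.
case: j => [|[|[|//]]] _ ot; [exact: dvd1n | exact: dvdnn |].
case/negP: ncT; apply/cyclicP; exists t; apply/eqP.
by rewrite eq_sym eqEcard cycle_subG Tt -orderE ot oT /=.
Qed.

(** A maximal subgroup [M] above [D] is normal in [P], and [D] is maximal in [M]. Hence ['Phi(M)]
    lies in [D] and is normal in [P], so it is trivial, and [M] is elementary abelian. *)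
Lemma pgroup_core_free_index_p2 (p : nat) (gT : finGroupType) (P D : {group gT}) :
    prime p -> p.-group P -> D \subset P -> #|P : D| = (p ^ 2)%N ->
    gcore D P = 1 -> p.-abelem D.
Proof.
move=> p_pr pP sDP oPD core1.
have p_gt1 := prime_gt1 p_pr.
have [defP | [M maxM sDM]] := maximal_exists sDP.
  by move/eqP: oPD; rewrite defP indexgg eq_sym -(expn0 p) eqn_exp2l.
have nsMP := p_maximal_normal pP maxM.
have sMP := normal_sub nsMP.
have oMD : #|M : D| = p.
  apply/eqP; rewrite -(eqn_pmul2l (prime_gt0 p_pr)) -{1}(p_maximal_index pP maxM).
  by rewrite Lagrange_index // oPD.
have pM := pgroupS sMP pP.
apply: (abelemS sDM); rewrite -trivg_Phi //.
rewrite -subG1 -core1; apply: gcore_max.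
  by apply/Phi_sub_max/p_index_maximal; rewrite ?oMD.
exact: gFnorm_trans (normal_norm nsMP).
Qed.

Lemma dihedral_generators (gT : finGroupType) (H : {group gT}) (n : nat) :
    1 < n -> H \isog 'D_(2 * n) ->
  exists x y : gT, [/\ H = <[x]> <*> <[y]> :> {set gT}, #|H| = (2 * n)%N,
    #[x] = n, y ^+ 2 = 1 & x ^ y = x^-1].
Proof.
move=> n_gt1 isoH; rewrite mul2n in isoH *.
have oH : #|H| = n.*2 by rewrite (card_isog isoH) card_dihedral.
have : H \homg 'D_n.*2 by apply: isog_hom.
rewrite Grp_dihedral // => /existsP[[x y]] /= /eqP[defH xn y2 xy].
exists x, y; split=> //.
have nxy : <[y]> \subset 'N(<[x]>) by rewrite norms_cycle xy groupV cycle_id.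
have ox : #[x] <= n by rewrite dvdn_leq ?(ltnW n_gt1) // order_dvdn xn.
have oy : #[y] <= 2 by rewrite dvdn_leq // order_dvdn y2.
(* The relations only bound the two orders by [n] and 2; the product formula with [#|H| = 2n] forces
   [#[x] >= n]. *)
have := mul_cardG <[x]> <[y]>; rewrite -norm_joinEr // defH oH -!orderE => oxy.
apply/eqP; rewrite eqn_leq ox -leq_double -[X in _ <= X]muln2.
apply: leq_trans (leq_mul (leqnn _) oy); rewrite oxy.
by rewrite leq_pmulr // cardG_gt0.
Qed.

(** * Core-free dihedral subgroups of index [p ^ 2] *)

Section NormalComplement.

Variables (gT : finGroupType) (G H : {group gT}) (p n : nat) (x y : gT).
Hypotheses (p_pr : prime p) (odd_p : odd p) (sHG : H \subset G).
Hypotheses (oGH : #|G : H| = (p ^ 2)%N) (core1 : gcore H G = 1).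
Hypotheses (n_gt1 : 1 < n) (defH : H = <[x]> <*> <[y]> :> {set gT}).
Hypotheses (oH : #|H| = (2 * n)%N) (ox : #[x] = n) (y2 : y ^+ 2 = 1) (xy : x ^ y = x^-1).

Let oG : #|G| = (#|H| * p ^ 2)%N. Proof. by rewrite -(Lagrange sHG) oGH. Qed.
Let p2_gt0 : 0 < p ^ 2. Proof. by rewrite expn_gt0 prime_gt0. Qed.
Let Hx : x \in H. Proof. by rewrite defH mem_gen // inE cycle_id. Qed.
Let Hy : y \in H. Proof. by rewrite defH mem_gen // inE cycle_id orbT. Qed.
Let sXH : <[x]> \subset H. Proof. by rewrite cycle_subG. Qed.
Let nsXH : <[x]> <| H.
Proof.
rewrite /normal sXH defH join_subG normG /=.
by rewrite norms_cycle xy groupV cycle_id.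
Qed.
Let oHX : #|H : <[x]>| = 2.
Proof. by rewrite -divgS // oH -orderE ox mulnK // ltnW. Qed.

Lemma normal_sub_stab_trivial (K : {group gT}) : K \subset H -> K <| G -> K :=: 1.
Proof. by move=> sKH /andP[_ nKG]; apply/trivgP; rewrite -core1 gcore_max. Qed.

Lemma dihedral_stab_solvable : solvable G.
Proof.
apply: (solvable_pnat_index p_pr odd_p sHG _ nsXH (cycle_cyclic x)).
  by rewrite oGH pnatX pnat_id.
by rewrite oHX.
Qed.

(** The index of ['O_p^'(G) :&: H] in ['O_p^'(G)] divides [p ^ 2] and is a [p']-number, so
    ['O_p^'(G)] lies in the core-free subgroup [H]. *)
Lemma pcore_self_cent : 'C_G('O_p(G)) \subset 'O_p(G).
Proof.
apply: cent_pcore_sub dihedral_stab_solvable _.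
apply: normal_sub_stab_trivial; last exact: pcore_normal.
have nsOG := pcore_normal p^' G.
have := index_normalI_dvd sHG nsOG; rewrite oGH => dv_p.
have : #|'O_p^'(G) : 'O_p^'(G) :&: H| == 1%N.
  apply/eqP/(@pnat_1 p); first by rewrite (pnat_dvd dv_p) // pnatX pnat_id.
  by rewrite (pnat_dvd (dvdn_indexg _ _)) ?[p^'.-nat _]pcore_pgroup.
by rewrite indexgI indexg_eq1.
Qed.

Lemma normal_complement_spec (T : {group gT}) :
    T <| G -> #|T| = (p ^ 2)%N -> T :&: H = 1 ->
  [/\ p.-abelem T, T ><| H = G & 'C_H(T) = 1].
Proof.
move=> nsTG oT tiTH; have [sTG nTG] := andP nsTG.
have nTH := subset_trans sHG nTG.
have defG : T * H = G.
  apply/eqP; rewrite eqEcard mul_subG // TI_cardMg // oT oG.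
  by rewrite mulnC leqnn.
have CHT1 : 'C_H(T) = 1.
  apply: (@normal_sub_stab_trivial 'C_H(T)%G); first exact: subsetIl.
  rewrite /normal subIset ?sHG //= -defG mul_subG //.
    by rewrite cents_norm // centsC subsetIr.
  by rewrite normsI ?normG // norms_cent.
split=> //; last by rewrite sdprodE.
(* On a cyclic [T] the involutions [y] and [x * y] would both invert every element, so [x] would
   centralise [T]. *)
apply: abelem_card_p2 => //; apply/negP=> cycT.
have pT : p.-group T by rewrite /pgroup oT pnatX pnat_id.
have x_n1 : x != 1 by rewrite -order_eq1 ox -(subnKC n_gt1).
have ncT z : z \in H -> z != 1 -> z \notin 'C(T).
  by move=> Hz; apply: contra => cTz; rewrite -in_set1 -[[set 1]]CHT1 inE Hz.
have nT z : z \in H -> z \in 'N(T) by apply: subsetP.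
have inv z : z \in H -> z ^+ 2 = 1 -> z != 1 -> {in T, forall t, t ^ z = t^-1}.
  by move=> Hz z2 z1; apply: (involution_inverts_cyclic p_pr odd_p) => //; auto.
have nyX : y \notin <[x]>.
  apply/negP=> Xy; have : H \subset <[x]> by rewrite defH join_subG subxx cycle_subG.
  by move/subset_leq_card; rewrite oH -orderE ox leqNgt mul2n -addnn -{1}[n]addn0 ltn_add2l ltnW.
have xy2 : (x * y) ^+ 2 = 1.
  by rewrite expgS expg1 {1}(conjgC x) xy -mulgA mulKg -expg2 y2.
have y_n1 : y != 1 by apply: contraNneq nyX => ->.
have xy_n1 : x * y != 1.
  apply: contraNneq nyX => xy1; rewrite -(mulKg x y) xy1 mulg1 groupV; exact: cycle_id.
case/negP: (ncT _ Hx x_n1); apply/centP=> t Tt.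
have Ttx : t ^ x \in T by rewrite memJ_norm ?nT.
have := inv _ (groupM Hx Hy) xy2 xy_n1 t Tt.
rewrite conjgM (inv _ Hy y2 y_n1) // => /invg_inj tx.
by apply/commute_sym/commgP/conjg_fixP.
Qed.

(** A Sylow subgroup has order [p ^ 2] and is abelian, so it centralises ['O_p(G)], which contains
    its own centraliser. *)
Lemma normal_complement_coprime : ~~ (p %| n) ->
  exists T : {group gT}, [/\ T <| G, #|T| = (p ^ 2)%N & T :&: H = 1].
Proof.
move=> p'n; have [P sylP] := Sylow_exists p G.
have [sPG pP _] := and3P sylP.
have p'H : p^'.-nat #|H|.
  rewrite oH p'natE // Euclid_dvdM // negb_or p'n andbT.
  by rewrite dvdn_prime2 //; apply: contraTneq odd_p => ->.
have oP : #|P| = (p ^ 2)%N.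
  rewrite (card_Hall sylP) oG (partnM _ (cardG_gt0 H) p2_gt0) part_p'nat // mul1n.
  by rewrite part_pnat_id ?pnatX ?pnat_id.
have sPO : P \subset 'O_p(G).
  apply: subset_trans pcore_self_cent; rewrite subsetI sPG.
  apply: subset_trans (centS (pcore_sub_Hall sylP)).
  exact: card_p2group_abelian oP.
have defP : P :=: 'O_p(G) by apply/eqP; rewrite eqEsubset sPO pcore_sub_Hall.
exists P; split=> //; first by rewrite defP pcore_normal.
by apply: coprime_TIg; rewrite (pnat_coprime pP).
Qed.

(** * The case where [p] divides [n] *)

Section WildCase.

Hypothesis p_n : p %| n.
Variables D P : {group gT}.
Hypotheses (defD : D :=: 'O_p(<[x]>)) (sylP : p.-Sylow(G) P) (sDP : D \subset P).

Let sPG : P \subset G. Proof. by case/and3P: sylP. Qed.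
Let pP : p.-group P. Proof. by case/and3P: sylP. Qed.
Let sDX : D \subset <[x]>. Proof. by rewrite defD pcore_sub. Qed.
Let sDH : D \subset H. Proof. exact: subset_trans sDX sXH. Qed.

Let sylD : p.-Sylow(H) D.
Proof.
rewrite pHallE sDH defD.
have /card_Hall-> := nilpotent_pcore_Hall p (abelian_nil (cycle_abelian x)).
rewrite -(Lagrange sXH) oHX partnM // -[X in X == _]muln1; apply/eqP; congr (_ * _)%N.
rewrite part_p'nat // p'natE // dvdn_prime2 //.
by apply: contraTneq odd_p => ->.
Qed.

Let defPH : P :&: H = D.
Proof.
apply: (sub_pHall sylD); [exact: pgroupS (subsetIl _ _) pP | | exact: subsetIr].
by rewrite subsetI sDP.
Qed.

Let oP : #|P| = (p ^ 2 * #|D|)%N.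
Proof.
rewrite (card_Hall sylP) oG (partnM _ (cardG_gt0 H) p2_gt0) (card_Hall sylD) mulnC.
by rewrite part_pnat_id // pnatX pnat_id.
Qed.

Let defG : P * H = G.
Proof.
apply/eqP; rewrite eqEcard mul_subG //=.
rewrite -(leq_pmul2r (cardG_gt0 D)) -{2}defPH -mul_cardG oP oG.
by rewrite -mulnA mulnC.
Qed.

(** Subgroups of the cyclic group [<[x]>] are normal in [H]; since [G = P * H], one that [P]
    normalises is normal in [G]. *)
Let coreDP (K : {group gT}) : K \subset D -> P \subset 'N(K) -> K :=: 1.
Proof.
move=> sKD nKP; apply: normal_sub_stab_trivial; first exact: subset_trans sKD sDH.
have nsKH : K <| H.
  apply: char_normal_trans nsXH; rewrite sub_cyclic_char ?cycle_cyclic //.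
  exact: subset_trans sKD sDX.
by rewrite /normal (subset_trans sKD) ?(subset_trans sDH) // -defG mul_subG // normal_norm.
Qed.

Let ntD : D :!=: 1.
Proof.
rewrite -cardG_gt1 (card_Hall sylD) oH p_part -(expn0 p) ltn_exp2l ?prime_gt1 //.
by rewrite logn_gt0 mem_primes p_pr muln_gt0 /= (ltnW n_gt1) dvdn_mull.
Qed.

(** [D] is core-free of index [p ^ 2] in [P], hence elementary abelian; it is also cyclic and
    nontrivial. *)
Let oD : #|D| = p.
Proof.
have core : gcore D P = 1.
  by apply: (@coreDP (gcore D P)%G); rewrite ?gcore_sub ?gcore_norm.
apply: cyclic_abelem_prime (cyclicS sDX (cycle_cyclic x)) ntD.
apply: (pgroup_core_free_index_p2 p_pr pP sDP _ core).
by rewrite -divgS // oP mulnK.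
Qed.

Let prD : prime #|D|. Proof. by rewrite oD. Qed.

Let oP3 : #|P| = (p ^ 3)%N. Proof. by rewrite oP oD -expnSr. Qed.

Let ncPP : ~~ abelian P.
Proof.
apply: contra ntD => cPP; apply/eqP/coreDP => //.
exact: cents_norm (subset_trans cPP (centS sDP)).
Qed.

Let oZ : #|'Z(P)| = p.
Proof.
apply: (card_center_extraspecial pP); apply: (p3group_extraspecial pP ncPP).
by rewrite oP3 pfactorK.
Qed.

Let abelPZ : p.-abelem (P / 'Z(P)).
Proof.
have [[<- _] _] : extraspecial P by apply: (p3group_extraspecial pP ncPP); rewrite oP3 pfactorK.
exact: Phi_quotient_abelem.
Qed.

Let tiDZ : D :&: 'Z(P) = 1.
Proof.
apply: (@coreDP (D :&: 'Z(P))%G); first exact: subsetIl.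
by rewrite cents_norm // centsC subIset // subsetIr orbT.
Qed.

(** [D / Z] is normal in [G / Z] because [P / Z] is abelian and [G = P * H]. A complement [L] to it
    meets [P / Z] in a normal subgroup, and [T] is the preimage of this intersection. *)
Lemma normal_complement_normal_Sylow : P <| G ->
  exists T : {group gT}, [/\ T <| G, #|T| = (p ^ 2)%N & T :&: H = 1].
Proof.
move=> nsPG; set Z := 'Z(P)%G.
have nsZG : Z <| G by apply: gFnormal_trans.
have nZG := normal_norm nsZG.
have nZP : P \subset 'N(Z) by apply: subset_trans nZG.
have nZD : D \subset 'N(Z) by apply: subset_trans nZP.
have nZH : H \subset 'N(Z) by apply: subset_trans nZG.
have sBP : D / Z \subset P / Z by apply: quotientS.
have cPP : abelian (P / Z) := abelem_abelian abelPZ.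
have nDH : H \subset 'N(D) by rewrite defD gFnorm_trans ?normal_norm.
have nsBG : D / Z <| G / Z.
  rewrite /normal quotientS ?(subset_trans sDP) //= -defG quotientMl // mul_subG //.
    exact: cents_norm (subset_trans cPP (centS sBP)).
  exact: quotient_norms.
(* Gaschutz: [D / Z] splits in the elementary abelian group [P / Z], whose index in [G / Z] is prime
   to [p], so it splits in [G / Z]. *)
have /splitsP[L /complP[tiBL defGZ]] : [splits G / Z, over D / Z].
  rewrite (@Gaschutz_split _ (G / Z)%G (D / Z)%G (P / Z)%G) ?quotientS //.
  - exact: abelem_splits abelPZ sBP.
  - exact: abelianS sBP cPP.
  - apply: (@pnat_coprime p).
      by apply: quotient_pgroup; apply: pgroupS pP.
    rewrite (pnat_dvd (index_quotient _)) ?subIset ?nZG //.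
    by case/and3P: sylP.
have sLG : L \subset G / Z by rewrite -defGZ mulG_subr.
have nsVG : (P / Z) :&: L <| G / Z.
  rewrite /normal subIset ?sLG ?orbT //= -defGZ mul_subG //.
    apply: cents_norm; apply: subset_trans (centS (subsetIl _ _)).
    exact: subset_trans sBP cPP.
  by rewrite normsI ?normG // (subset_trans sLG) // normal_norm // quotient_normal.
have [T defT sZT nsTG] := inv_quotientN nsZG nsVG.
have sTG := normal_sub nsTG; have nZT := subset_trans sTG nZG.
have sTP : T \subset P.
  have : T / Z \subset P / Z by rewrite /= -defT subsetIl.
  by rewrite quotientSK // (mulSGid (center_sub P)).
have oB : #|D / Z| = p.
  by rewrite -oD; apply/esym/card_isog/quotient_isog => //; rewrite setIC tiDZ.
have oT : #|T| = (p ^ 2)%N.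
  have oV : (#|D / Z| * #|(P / Z) :&: L|)%N = #|P / Z|.
    rewrite -TI_cardMg; last by rewrite setIA (setIidPl sBP).
    by rewrite /= setIC group_modl // defGZ (setIidPr _) ?quotientS.
  rewrite -(Lagrange sZT) oZ -card_quotient // -defT -{1}oB oV.
  by rewrite card_quotient // -divgS ?center_sub // oP3 oZ expnSr mulnK ?prime_gt0.
exists T; split=> //.
(* The image of [T :&: H] lies in both [D / Z] and [L], so [T :&: H] lies in [D :&: 'Z(P) = 1]. *)
have sTHD : T :&: H \subset D by rewrite -defPH setSI.
apply/trivgP; rewrite -tiDZ subsetI sTHD /=.
rewrite -quotient_sub1; last by rewrite subIset ?nZT.
rewrite -tiBL subsetI quotientS //=.
by apply: subset_trans (quotientS _ (subsetIl _ _)) _; rewrite -defT subsetIr.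
Qed.

Let nDH : H \subset 'N(D). Proof. by rewrite defD gFnorm_trans ?normal_norm. Qed.

Let sQP : 'O_p(G) \subset P. Proof. exact: pcore_sub_Hall. Qed.

(** * Excluding a Sylow subgroup that is not normal *)

Section NonNormalSylow.

Hypothesis not_sPQ : ~~ (P \subset 'O_p(G)).
Let Q := 'O_p(G)%G.

Let sZQ : 'Z(P) \subset Q.
Proof.
apply: subset_trans pcore_self_cent; rewrite setISS //.
exact: centS sQP.
Qed.

(** [Q] lies strictly between ['Z(P)] and [P]: if [Q] were inside ['Z(P)], then [P] would centralise
    [Q] and so lie in it. *)
Let oQ : #|Q| = (p ^ 2)%N.
Proof.
have : #|Q| %| p ^ 3 by rewrite -oP3 cardSg.
case/dvdn_pfactor=> // j le_j3 oQ.
suff : 1 < j < 3 by rewrite oQ; case: j {le_j3 oQ} => [|[|[|]]].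
apply/andP; split.
- rewrite -(ltn_exp2l _ _ (prime_gt1 p_pr)) -oQ expn1 -oZ.
  apply: proper_card; rewrite properE sZQ /=; apply: contra not_sPQ => sQZ.
  apply: subset_trans pcore_self_cent; rewrite subsetI sPG centsC.
  exact: subset_trans sQZ (subsetIr _ _).
- rewrite -(ltn_exp2l _ _ (prime_gt1 p_pr)) -oQ -oP3.
  by apply: proper_card; rewrite properE sQP.
Qed.

Let cQQ : abelian Q. Proof. exact: card_p2group_abelian oQ. Qed.

(** Otherwise [D] meets [Q] trivially and [P = Q <*> D] is normalised by [H], hence normal in
    [G]. *)
Let sDQ : D \subset Q.
Proof.
have [tiDQ | ntDQ] := eqVneq (D :&: Q) 1; last exact: prime_meetG ntDQ.
case/negP: not_sPQ; apply: pcore_max => //.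
have nQD : D \subset 'N(Q) by apply: subset_trans (gFnorm _ _); apply: subset_trans sDH sHG.
have defP : Q <*> D = P.
  apply/eqP; rewrite eqEcard join_subG sQP sDP norm_joinEr //.
  by rewrite TI_cardMg 1?setIC // oQ oD oP3 -expnSr leqnn.
rewrite /normal sPG -defG mul_subG ?normG // -defP normsY //.
exact: subset_trans sHG (gFnorm _ _).
Qed.

Let defQH : Q :&: H = D.
Proof. by apply/eqP; rewrite eqEsubset subsetI sDQ sDH -defPH setSI. Qed.

Let oGN : #|G : 'N_G(D)| = p.
Proof.
have sQN : Q \subset 'N(D) := cents_norm (subset_trans cQQ (centS sDQ)).
have nQH : H \subset 'N(Q) := subset_trans sHG (gFnorm _ _).
have sQHN : Q <*> H \subset 'N_G(D) by rewrite subsetI !join_subG pcore_sub sHG sQN nDH.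
have oQH : #|G : Q <*> H| = p.
  have := mul_cardG Q H; rewrite defQH -norm_joinEr // oQ oD => oQH.
  have sQHG : Q <*> H \subset G by rewrite join_subG pcore_sub.
  apply/eqP; rewrite -(eqn_pmul2l (cardG_gt0 (Q <*> H))) Lagrange // oG.
  by rewrite -oQH mulnC.
have := indexgS G sQHN; rewrite oQH dvdn_divisors ?prime_gt0 //.
have : #|G : 'N_G(D)| %| p by rewrite -oQH indexgS.
case/primeP: p_pr => _ dv_p /dv_p/pred2P[/eqP|] // oGN1 _.
case/eqP: ntD; apply: normal_sub_stab_trivial => //.
rewrite /normal (subset_trans sDH) //=.
by rewrite indexg_eq1 in oGN1; apply: subset_trans oGN1 (subsetIr _ _).
Qed.

(** The [p] conjugates of [D^#] are disjoint and fill [p * (p - 1)] of the [p ^ 2 - 1] elements of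
    [Q^#]. The remaining [p - 1] elements form a [G]-invariant set, which is ['Z(P)^#]. *)
Let nsZG : 'Z(P) <| G.
Proof.
rewrite /normal (subset_trans sZQ) ?pcore_sub //=.
pose S := class_support D^# G.
have tiD : normedTI D^# G 'N_G(D).
  apply/normedTI_P; split.
  - by rewrite setD_eq0 subG1.
  - by rewrite normD1.
  move=> g Gg; rewrite -setI_eq0 conjD1g -setDIl setD_eq0 subG1 => ntDg.
  rewrite inE Gg; apply/normP/eqP.
  by rewrite eq_sym eqEcard cardJg leqnn andbT (prime_meetG prD).
have oS : #|S| = (p.-1 * p)%N.
  by rewrite (card_support_normedTI tiD) oGN; congr (_ * _)%N; rewrite -oD (cardsD1 1 D) group1.
have sSQ : S \subset Q^#.
  apply/subsetP=> _ /imset2P[d g /setD1P[nt_d Dd] Gg ->].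
  rewrite !inE conjg_eq1 nt_d memJ_norm ?(subsetP sDQ) //.
  exact: subsetP (gFnorm _ _) _ Gg.
suff -> : 'N('Z(P)) = 'N(Q^# :\: S).
  rewrite normsD ?class_support_norm // normD1; exact: gFnorm.
rewrite -normD1; congr 'N(_); apply/eqP; rewrite eqEcard; apply/andP; split.
  apply/subsetP=> z /setD1P[nt_z Zz]; rewrite !inE nt_z (subsetP sZQ) // !andbT.
  (* If a central element of [P] were conjugate to a generator [d] of [D], a conjugate of [P] would
     centralise [D], although ['N_G(D)] has index [p]. *)
  apply/negP=> /imset2P[d g /setD1P[nt_d Dd] Gg def_z].
  have defDd : D :=: <[d]>.
    by apply: nt_gen_prime; rewrite // !inE nt_d.
  have sPN : P :^ g^-1 \subset 'N_G(D).
    rewrite subsetI conj_subG ?groupV //= defDd cents_norm // cent_cycle.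
    rewrite sub_conjgV -cent1J -def_z sub_cent1; case/centerP: Zz => _.
    by move=> cPz; apply/centP=> u Pu; apply: cPz.
  have : p^'.-nat #|G : 'N_G(D)|.
    apply: pnat_dvd (indexgS G sPN) _.
    by rewrite -(conjGid (groupVr Gg)) indexJg; case/and3P: sylP.
  by rewrite oGN p'natE // dvdnn.
rewrite (cardsD Q^# S) (setIidPr sSQ) oS.
have -> : #|Q^#| = (p ^ 2).-1 by rewrite -oQ (cardsD1 1 Q) group1.
have -> : #|'Z(P)^#| = p.-1 by rewrite -oZ (cardsD1 1 'Z(P)) group1.
by case: (p) (prime_gt0 p_pr) => // q _; rewrite leq_subLR -mulnn mulSn /= mulnC addnC mulSn.
Qed.

(** The normal subgroup [K] of elements acting trivially on [R] and on [Q / R] contains [P]. It is a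
    [p]-group, because [p]-th powers of its elements centralise [Q] and so lie in [Q]; hence [P]
    lies in ['O_p(G)]. *)
Lemma nonnormal_Sylow_absurd : False.
Proof.
set R := 'Z(P)%G; have nRG : G \subset 'N(R) := normal_norm nsZG.
pose K := ('C_G(R) :&: coset R @*^-1 'C_(G / R)(Q / R))%G.
have nsKG : K <| G.
  apply: normalI.
    by have := subcent_normal G R; rewrite (setIidPl nRG).
  have nQG : G / R \subset 'N(Q / R) by rewrite quotient_norms // gFnorm.
  have := subcent_normal (G / R) (Q / R); rewrite (setIidPl nQG).
  by rewrite -cosetpre_normal quotientGK.
have sPK : P \subset K.
  rewrite subsetI subsetI sPG /= centsC subsetIr /=.
  rewrite -sub_quotient_pre ?(subset_trans sPG) // subsetI quotientS //=.
  apply: subset_trans (centS (quotientS _ sQP)).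
  exact: abelem_abelian abelPZ.
have KpQ a : a \in K -> a ^+ p \in Q.
  case/setIP=> /setIP[Ga cRa] /morphpreP[nRa /setIP[_ cQa]].
  apply: (subsetP pcore_self_cent); rewrite inE groupX //=.
  apply/centP=> u Qu; apply/commute_sym/commgP/conjg_fixP.
  have Pu := subsetP sQP u Qu.
  have nRu : u \in 'N(R) by apply: (subsetP nRG); apply: (subsetP sPG).
  have Rua : [~ u, a] \in R.
    apply: coset_idr; first by rewrite groupR.
    rewrite morphR //; apply/eqP/commgP/commute_sym.
    by apply: (centP cQa); rewrite mem_quotient.
  (* The commutator lies in [R], which [a] centralises, so it accumulates as a plain power and
     disappears at [k = p = #|R|]. *)
  have step k : u ^ (a ^+ k) = u * [~ u, a] ^+ k.
    elim: k => [|k IHk]; first by rewrite expg0 conjg1 mulg1.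
    rewrite expgSr conjgM IHk conjMg conjg_mulR expgS -mulgA; congr (_ * (_ * _)).
    by apply/conjg_fixP/commgP/commute_sym; apply: (centP cRa); rewrite groupX.
  by rewrite step -oZ expg_cardG ?mulg1.
case/negP: not_sPQ; apply: subset_trans sPK _; apply: pcore_max nsKG.
apply/pgroupP=> q q_pr q_K; rewrite inE /=.
have [a Ka oa] := Cauchy q_pr q_K.
rewrite -dvdn_prime2 //; apply: contraT => q'p.
have : a \in Q.
  have co_ap : coprime #[a] p by rewrite oa prime_coprime.
  (* As [#[a]] is prime to [p], [a] is a power of [a ^+ p]. *)
  rewrite -(expgK co_ap (cycle_id a)) groupX // KpQ //.
by move/order_dvdG; rewrite oa oQ Euclid_dvdX // (negPf q'p).
Qed.

End NonNormalSylow.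

End WildCase.
Lemma normal_complement :
  exists T : {group gT},
    [/\ T <| G, #|T| = (p ^ 2)%N, p.-abelem T, T ><| H = G & 'C_H(T) = 1].
Proof.
suff [T [nsTG oT tiTH]] : exists T : {group gT}, [/\ T <| G, #|T| = (p ^ 2)%N & T :&: H = 1].
  by have [] := normal_complement_spec nsTG oT tiTH; exists T.
have [p_n | p'n] := boolP (p %| n); last exact: normal_complement_coprime.
pose D := 'O_p(<[x]>)%G.
have sDG : D \subset G by rewrite gFsub_trans // (subset_trans sXH).
have [P sylP sDP] := Sylow_superset sDG (pcore_pgroup _ _).
apply: (normal_complement_normal_Sylow p_n (erefl _ : D :=: _) sylP sDP).
suff -> : P :=: 'O_p(G) by apply: pcore_normal.
apply/eqP; rewrite eqEsubset pcore_sub_Hall // andbT; apply: contraT => not_sPQ.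
by case: (nonnormal_Sylow_absurd p_n (erefl _ : D :=: _) sylP sDP).
Qed.

End NormalComplement.

(** * Affine groups *)

Section AffinePerms.

Variable p : nat.
Local Notation F := 'F_p.
Local Notation V := 'rV[F]_2.

Lemma lin_permE (A : 'M[F]_2) (v : V) : A \in unitmx -> lin_perm A v = (v *m A)%R.
Proof.
move=> uA; rewrite /lin_perm; move: (erefl (A \in unitmx)).
case: {2 3}(A \in unitmx) => h; first by rewrite permE.
by rewrite uA in h.
Qed.

Lemma trans_permE (a v : V) : trans_perm a v = (v + a)%R.
Proof. by rewrite permE. Qed.

Lemma trans_permD (a b : V) : trans_perm (a + b)%R = trans_perm a * trans_perm b.
Proof. by apply/permP=> v; rewrite permM !trans_permE addrA. Qed.

Lemma trans_perm_inj : injective (@trans_perm p).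
Proof. by move=> a b /permP/(_ 0%R); rewrite !trans_permE !add0r. Qed.

Lemma lin_permM (A B : 'M[F]_2) : A \in unitmx -> B \in unitmx ->
  lin_perm (A *m B)%R = lin_perm A * lin_perm B.
Proof.
move=> uA uB; apply/permP=> v.
by rewrite permM !lin_permE ?unitmx_mul ?uA // mulmxA.
Qed.

Lemma trans_lin_permJ (a : V) (A : 'M[F]_2) : A \in unitmx ->
  trans_perm a ^ lin_perm A = trans_perm (a *m A)%R.
Proof.
move=> uA; rewrite conjgE; apply: (canLR (mulKg _)).
apply/permP=> v; rewrite !permM !trans_permE !lin_permE //.
exact: mulmxDl.
Qed.

Lemma mulmx_ext (A B : 'M[F]_2) : (forall v : V, v *m A = v *m B)%R -> A = B.
Proof. by move=> eqAB; apply/row_matrixP=> i; rewrite !rowE eqAB. Qed.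

(** Every scalar of the prime field is a multiple of 1, so additivity already gives linearity. *)
Lemma additive_mulmx (f : V -> V) : (forall u v : V, f (u + v)%R = (f u + f v)%R) ->
  exists A : 'M[F]_2, forall v, f v = (v *m A)%R.
Proof.
move=> fD; exists (\matrix_i f (delta_mx 0%R i))%R => v.
have f0 : f 0%R = 0%R by apply: (addrI (f 0%R)); rewrite -fD !addr0.
have fX k u : f (u *+ k)%R = (f u *+ k)%R.
  by elim: k => [|k IHk]; rewrite ?mulr0n // !mulrS fD IHk.
have fZ (a : F) u : f (a *: u)%R = (a *: f u)%R.
  by rewrite -[a]natr_Zp !scaler_nat fX.
rewrite {1}[v]row_sum_delta mulmx_sum_row (big_morph f fD f0).
by apply: eq_bigr => i _; rewrite fZ rowK.
Qed.

End AffinePerms.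

(** [A] is the matrix of conjugation by [h] in the coordinates [phi]. Right conjugation on row
    vectors makes the correspondence multiplicative without reversing the order. *)
Definition acts_by (p : nat) (gT : finGroupType) (phi : 'rV['F_p]_2 -> gT) (h : gT)
  (A : 'M['F_p]_2) := forall v, phi v ^ h = phi (v *m A)%R.

Section AffineIsog.

Variables (p : nat) (gT : finGroupType) (G T H : {group gT}).
Local Notation F := 'F_p.
Local Notation V := 'rV[F]_2.
Variable phi : V -> gT.
Hypotheses (sdG : T ><| H = G) (cH1 : 'C_H(T) = 1).
Hypotheses (phi_inj : injective phi) (phiD : forall u v : V, phi (u + v)%R = phi u * phi v).
Hypothesis im_phi : phi @: [set: V] = T.

(** The inverse of [phi] on [T], with default value 0 elsewhere. *)
Let psi (t : gT) : V := odflt 0%R [pick v | phi v == t].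

Let phiT v : phi v \in T. Proof. by rewrite -im_phi imset_f. Qed.
Let phiK : cancel phi psi.
Proof.
move=> v; rewrite /psi; case: pickP => [u /eqP/phi_inj //|/(_ v)].
by rewrite eqxx.
Qed.
Let psiK : {in T, cancel psi phi}.
Proof. by move=> t; rewrite -im_phi => /imsetP[v _ ->]; rewrite phiK. Qed.

Let nTH : H \subset 'N(T). Proof. by case/sdprodP: sdG. Qed.

Lemma acts_by_inj h A B : acts_by phi h A -> acts_by phi h B -> A = B.
Proof. by move=> hA hB; apply: mulmx_ext => v; apply: phi_inj; rewrite -hA -hB. Qed.

Lemma acts_byM h k A B : acts_by phi h A -> acts_by phi k B -> acts_by phi (h * k) (A *m B)%R.
Proof. by move=> hA kB v; rewrite conjgM hA kB mulmxA. Qed.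

Lemma acts_by1 : acts_by phi 1 1%:M%R.
Proof. by move=> v; rewrite conjg1 mulmx1. Qed.

Lemma acts_by_exists h : h \in 'N(T) -> exists A, acts_by phi h A.
Proof.
move=> nTh; have [|A hA] := @additive_mulmx p (fun v => psi (phi v ^ h)).
  move=> u v; apply: phi_inj.
  by rewrite [RHS]phiD !psiK ?memJ_norm ?phiT // phiD conjMg.
by exists A => v; rewrite -hA psiK // memJ_norm.
Qed.

Lemma acts_by_unit h A : h \in 'N(T) -> acts_by phi h A -> A \in unitmx.
Proof.
move=> nTh hA; have [|B hB] := @acts_by_exists h^-1; first by rewrite groupV.
have := acts_byM hA hB; rewrite mulgV => /acts_by_inj-/(_ _ acts_by1).
by case/mulmx1_unit.
Qed.

Let mat h := (\matrix_i psi (phi (delta_mx 0 i) ^ h)%g)%R.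

Let matP h : h \in 'N(T) -> acts_by phi h (mat h).
Proof.
move=> nTh; have [A hA] := acts_by_exists nTh.
suff -> : mat h = A by [].
by apply/row_matrixP=> i; rewrite rowK hA phiK rowE.
Qed.

Let mat_unit h : h \in 'N(T) -> mat h \in unitmx.
Proof. by move=> nTh; apply: acts_by_unit (matP nTh). Qed.

Let fT t := trans_perm (psi t).
Let fH h := lin_perm (mat h).

Let fTM : {in T &, {morph fT : s t / s * t}}.
Proof.
move=> s t Ts Tt; rewrite /fT -trans_permD; congr trans_perm.
by apply: phi_inj; rewrite phiD !psiK ?groupM.
Qed.

Let fHM : {in H &, {morph fH : h k / h * k}}.
Proof.
move=> h k /(subsetP nTH) nh /(subsetP nTH) nk; rewrite /fH -lin_permM ?mat_unit //.
congr lin_perm; apply: acts_by_inj (acts_byM (matP nh) (matP nk)).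
by apply: matP; rewrite groupM.
Qed.

Let mT := Morphism fTM.
Let mH := Morphism fHM.

Let actf : {in T & H, morph_act 'J 'J mT mH}.
Proof.
move=> t h Tt /(subsetP nTH) nh /=.
rewrite /fT /fH trans_lin_permJ ?mat_unit //; congr trans_perm.
by apply: phi_inj; rewrite -matP // !psiK ?memJ_norm.
Qed.

(* The linear parts are matched by the two conditions on [S] and [L] rather than by a
   bijection, so that [S] and [L] may list generators redundantly. *)
Lemma isog_affine_gen (L : seq 'M[F]_2) (S : {set gT}) :
    <<S>> = H ->
    {in S, forall h, exists2 A, A \in L & acts_by phi h A} ->
    {in L, forall A, exists2 h, h \in H & acts_by phi h A} ->
  G \isog affine_gen p L.
Proof.
move=> defH SL LS.
have fHE h A : h \in H -> acts_by phi h A -> fH h = lin_perm A.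
  by move=> /(subsetP nTH)/matP hM hA; rewrite /fH (acts_by_inj hM hA).
(* The kernel of [mH] centralises [T], hence is trivial; a permutation in both images is a
   translation that fixes 0. *)
have inj_f : 'injm (sdprodm sdG actf).
  rewrite injm_sdprodm; apply/and3P; split.
  - apply/injmP=> s t Ts Tt /trans_perm_inj eqst.
    by rewrite -(psiK Ts) -(psiK Tt) eqst.
  - apply/subsetP=> h /morphpreP[Hh /set1P fh1].
    rewrite -[[1]]cH1 inE Hh; apply/centP=> t Tt.
    apply/commute_sym/commgP/conjg_fixP.
    have nh := subsetP nTH h Hh.
    rewrite -(psiK Tt) (matP nh) -lin_permE ?mat_unit //.
    by rewrite -[lin_perm _]/(mH h) fh1 perm1.
  - rewrite -subG1; apply/subsetP=> s /setIP[/morphimP[t _ Tt ->]].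
    case/morphimP=> h _ Hh /permP/(_ 0%R).
    rewrite /= /fT /fH trans_permE add0r lin_permE ?mat_unit ?(subsetP nTH) //.
    rewrite mul0mx inE => ->; apply/eqP/permP=> v.
    by rewrite trans_permE addr0 perm1.
suff -> : affine_gen p L = sdprodm sdG actf @* G by apply: sub_isog.
rewrite im_sdprodm /affine_gen.
have imT : mT @* T = transl_grp p.
  rewrite morphimEdom; apply/setP=> s; apply/imsetP/imsetP=> [[t Tt ->]|[a _ ->]].
    by exists (psi t).
  by exists (phi a); rewrite //= /fT phiK.
apply/eqP; rewrite eqEsubset; apply/andP; split.
  rewrite -(im_sdprodm sdG actf) gen_subG /= im_sdprodm -imT subUset.
  rewrite mulG_subl /=; apply/subsetP=> _ /imsetP[A LA ->].
  have [h Hh hA] := LS A LA.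
  by rewrite (subsetP (mulG_subr _ _)) // -(fHE h) //; apply/morphimP; exists h.
rewrite -imT mul_subG //; first by rewrite sub_gen // subsetUl.
have sSH : S \subset H by rewrite -gen_subG defH.
have -> : mH @* H = <<mH @* S>> by rewrite -morphim_gen // defH.
rewrite gen_subG; apply/subsetP=> _ /morphimP[h Hh Sh ->].
have [A LA hA] := SL h Sh.
by rewrite /= (fHE h A) // mem_gen // inE imset_f ?orbT.
Qed.

End AffineIsog.

(** * 2 x 2 matrices *)

Section Matrices2.
Local Open Scope ring_scope.
Variable F : fieldType.
Implicit Types (a b c d : F) (A B X Y : 'M[F]_2).

Lemma mx2P A : exists a b c d, A = mx2 a b c d.
Proof.
exists (A 0 0), (A 0 1), (A 1 0), (A 1 1); apply/matrixP=> i j; rewrite mxE.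
case: i => [[|[|//]] ?]; case: j => [[|[|//]] ?]; congr (A _ _); exact: val_inj.
Qed.

Lemma mx2_inj a b c d a' b' c' d' :
  mx2 a b c d = mx2 a' b' c' d' -> [/\ a = a', b = b', c = c' & d = d'].
Proof.
move/matrixP=> E; split.
- by have := E 0 0; rewrite !mxE.
- by have := E 0 1; rewrite !mxE.
- by have := E 1 0; rewrite !mxE.
- by have := E 1 1; rewrite !mxE.
Qed.

Lemma mul_mx2 a b c d a' b' c' d' : mx2 a b c d *m mx2 a' b' c' d' =
  mx2 (a * a' + b * c') (a * b' + b * d') (c * a' + d * c') (c * b' + d * d').
Proof.
apply/matrixP=> i j; rewrite !mxE !big_ord_recl big_ord0 !mxE /= addr0.
by case: i => [[|[|//]] ?]; case: j => [[|[|//]] ?].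
Qed.

Lemma mx2_scalar a : a%:M = mx2 a 0 0 a.
Proof.
apply/matrixP=> i j; rewrite !mxE.
by case: i => [[|[|//]] ?]; case: j => [[|[|//]] ?].
Qed.

Lemma mx2N a b c d : - mx2 a b c d = mx2 (- a) (- b) (- c) (- d).
Proof.
apply/matrixP=> i j; rewrite !mxE.
by case: i => [[|[|//]] ?]; case: j => [[|[|//]] ?].
Qed.

Lemma mx2_unit a b c d : a * d - b * c != 0 -> mx2 a b c d \in unitmx.
Proof.
move=> nz; set k := a * d - b * c in nz *.
have : mx2 a b c d *m mx2 (d / k) (- b / k) (- c / k) (a / k) = 1%:M.
  rewrite mul_mx2 mx2_scalar; congr mx2; rewrite /k; field; exact: nz.
by case/mulmx1_unit.
Qed.

Definition rv2 a b : 'rV[F]_2 := \row_(j < 2) if j == 0 :> nat then a else b.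

Lemma rv2P (v : 'rV[F]_2) : v = rv2 (v 0 0) (v 0 1).
Proof.
apply/rowP=> j; rewrite mxE.
by case: j => [[|[|//]] ?]; congr (v _ _); apply: val_inj.
Qed.

Lemma rv2_0 a b : rv2 a b 0 0 = a. Proof. by rewrite mxE. Qed.
Lemma rv2_1 a b : rv2 a b 0 1 = b. Proof. by rewrite mxE. Qed.

Lemma rv2D a b a' b' : rv2 a b + rv2 a' b' = rv2 (a + a') (b + b').
Proof. by apply/rowP=> j; rewrite !mxE; case: ifP. Qed.

Lemma mul_rv2_mx2 u v a b c d :
  rv2 u v *m mx2 a b c d = rv2 (u * a + v * c) (u * b + v * d).
Proof.
apply/rowP=> j; rewrite !mxE !big_ord_recl big_ord0 !mxE /= addr0.
by case: j => [[|[|//]] ?].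
Qed.

Lemma expr_mx2_upper b k : (mx2 1 b 0 1 : 'M[F]_2) ^+ k = mx2 1 (b *+ k) 0 1.
Proof.
elim: k => [|k IHk]; first by rewrite expr0 mulr0n -mx2_scalar.
rewrite exprS IHk -mulmxE mul_mx2; congr mx2; rewrite ?mulrSr; ring.
Qed.

Lemma expr_mx2_lower c k : (mx2 1 0 c 1 : 'M[F]_2) ^+ k = mx2 1 0 (c *+ k) 1.
Proof.
elim: k => [|k IHk]; first by rewrite expr0 mulr0n -mx2_scalar.
rewrite exprS IHk -mulmxE mul_mx2; congr mx2; rewrite ?mulrSr; ring.
Qed.

Lemma expr_mx2_diag a d k : (mx2 a 0 0 d : 'M[F]_2) ^+ k = mx2 (a ^+ k) 0 0 (d ^+ k).
Proof.
elim: k => [|k IHk]; first by rewrite !expr0 -mx2_scalar.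
rewrite exprS IHk -mulmxE mul_mx2 !exprS; congr mx2; ring.
Qed.

(** The matrix is [a + f J] with [J ^+ 2 = theta]. Taking [p]-th powers is additive on commuting
    matrices in characteristic [p], and [J ^+ p = theta ^+ p.-1./2 * J = - J]. *)
Lemma mx2_Frobenius p a f theta : p \in [pchar F] -> odd p ->
    a ^+ p = a -> f ^+ p = f -> theta ^+ p.-1./2 = -1 ->
  (mx2 a (f * theta) f a : 'M[F]_2) ^+ p = mx2 a (- (f * theta)) (- f) a.
Proof.
move=> pF odd_p ap fp thp; pose J : 'M[F]_2 := mx2 0 theta 1 0.
have JJ : J ^+ 2 = theta%:M.
  by rewrite expr2 -mulmxE mul_mx2 mx2_scalar; congr mx2; ring.
have linE u v : u%:M + v%:M *m J = mx2 u (v * theta) v u.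
  rewrite !mx2_scalar mul_mx2; apply/matrixP=> i j; rewrite !mxE.
  by case: i => [[|[|//]] ?]; case: j => [[|[|//]] ?] /=; ring.
have pM : p \in [pchar 'M[F]_2] by rewrite pchar_lalg.
have comJ u : GRing.comm (u%:M : 'M[F]_2) J by rewrite /GRing.comm -!mulmxE scalar_mxC.
have XM u k : (u%:M : 'M[F]_2) ^+ k = (u ^+ k)%:M by rewrite rmorphXn.
rewrite -linE -(pFrobenius_autE pM) pFrobenius_autD_comm; last first.
  by apply: commrM; rewrite /GRing.comm ?comJ // -!mulmxE scalar_mxC.
rewrite !pFrobenius_autE mulmxE exprMn_comm ?XM // ?ap ?fp //.
have -> : J ^+ p = - J.
  have -> : p = (2 * p.-1./2).+1.
    by rewrite mul2n even_halfK; case: (p) odd_p.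
  by rewrite exprS exprM JJ XM thp raddfN /= mulrN mulr1.
rewrite mulrN -mulNr -mulmxE -raddfN /= linE; congr mx2; ring.
Qed.

Hypothesis nz2 : 2%:R != 0 :> F.

Lemma mx2_oppr1_neq1 : -1 != 1 :> 'M[F]_2.
Proof.
rewrite -[1]/(1%:M) mx2_scalar mx2N; apply: contra nz2 => /eqP/mx2_inj[E1 _ _ _].
by rewrite mulr2n -{1}E1 addNr.
Qed.

(** A nonzero trace would make [Y] scalar. Otherwise the rows of [B] are left eigenvectors for 1 and
    -1: the first rows of [Y + 1] and [Y - 1] if [b != 0], their second rows if [c != 0]. *)
Lemma mx2_involution Y : Y *m Y = 1%:M -> Y != 1%:M -> Y != (-1)%:M ->
  exists2 B, B \in unitmx & B *m Y = mx2 1 0 0 (-1) *m B.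
Proof.
have [a [b [c [d ->]]]] := mx2P Y.
rewrite mul_mx2 !mx2_scalar => /mx2_inj[E1 E2 E3 E4] Y1 YN1.
have [s0 | s_nz] := eqVneq (a + d) 0; last first.
  have b0 : b = 0 by apply: (mulfI s_nz); rewrite mulr0 -[RHS]E2; ring.
  have c0 : c = 0 by apply: (mulfI s_nz); rewrite mulr0 -[RHS]E3; ring.
  have ad : a = d.
    apply: (mulfI s_nz); apply/eqP; rewrite -subr_eq0; apply/eqP.
    transitivity ((a * a + b * c) - (c * b + d * d)); last by rewrite E1 E4 subrr.
    ring.
  have : a ^+ 2 == 1 by rewrite -E1 b0 mul0r addr0 expr2.
  rewrite sqrf_eq1 => /orP[] /eqP a1; [case/eqP: Y1 | case/eqP: YN1].
    by rewrite b0 c0 -ad a1.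
  by rewrite b0 c0 -ad a1.
have dE : d = - a by apply/eqP; rewrite -addr_eq0 addrC s0.
subst d; clear s0 E2 E3 E4.
have [b0 | nzb] := eqVneq b 0; last first.
  exists (mx2 (1 + a) b (a - 1) b).
    apply: mx2_unit.
    by rewrite (_ : _ - _ = 2%:R * b) ?mulf_neq0 //; ring.
  rewrite !mul_mx2; congr mx2; rewrite ?mulr0 ?mul0r ?addr0 ?add0r.
  - transitivity (a + (a * a + b * c)); first ring. by rewrite E1; ring.
  - ring.
  - transitivity (- a + (a * a + b * c)); first ring. by rewrite E1; ring.
  - ring.
have [c0 | nzc] := eqVneq c 0; last first.
  exists (mx2 c (1 - a) c (- 1 - a)).
    apply: mx2_unit.
    by rewrite (_ : _ - _ = 2%:R * - c) ?mulf_neq0 ?oppr_eq0 //; ring.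
  rewrite b0 mul0r addr0 in E1.
  rewrite !mul_mx2 b0; congr mx2; rewrite ?mulr0 ?mul0r ?addr0 ?add0r.
  - ring.
  - transitivity (a * a - a); first ring. by rewrite E1; ring.
  - ring.
  - transitivity (a * a + a); first ring. by rewrite E1; ring.
have : a ^+ 2 == 1 by rewrite -E1 b0 mul0r addr0 expr2.
rewrite sqrf_eq1 b0 c0 => /orP[] /eqP ->.
  by exists 1%:M; rewrite ?unitmx1 // mul1mx mulmx1.
exists (mx2 0 1 1 0); first by apply: mx2_unit; rewrite mul0r sub0r mul1r oppr_eq0 oner_eq0.
by rewrite !mul_mx2; congr mx2; ring.
Qed.

(** In an eigenbasis of [Y] the commuting involution [X] is diagonal with entries 1 or -1; excluding
    1, -1 and [Y] leaves [X = - Y]. *)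
Lemma mx2_commuting_involutions X Y :
    X *m X = 1%:M -> Y *m Y = 1%:M -> X *m Y = Y *m X ->
    X != 1%:M -> X != (-1)%:M -> Y != 1%:M -> Y != (-1)%:M -> X != Y ->
  X *m Y = (-1)%:M.
Proof.
move=> XX YY XYC X1 XN1 Y1 YN1 XY.
have [B uB BY] := mx2_involution YY Y1 YN1.
have Binj : injective (mulmx B : 'M[F]_2 -> 'M[F]_2) := can_inj (mulKmx uB).
have invBinj : injective (mulmx^~ B : 'M[F]_2 -> 'M[F]_2) := can_inj (mulmxK uB).
have [a [b [c [d defX]]]] := mx2P (B *m X *m invmx B).
have BX : B *m X = mx2 a b c d *m B by rewrite -defX mulmxKV.
have : mx2 a b c d *m mx2 1 0 0 (-1) = mx2 1 0 0 (-1) *m mx2 a b c d.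
  by apply: invBinj; rewrite -!mulmxA -BY -BX !mulmxA -BY -BX -!mulmxA XYC.
have : mx2 a b c d *m mx2 a b c d = mx2 1 0 0 1.
  by apply: invBinj; rewrite -!mulmxA -BX mulmxA -BX -mulmxA XX -mx2_scalar mul1mx mulmx1.
rewrite !mul_mx2 => /mx2_inj[a2 _ _ d2] /mx2_inj[_ eb ec _].
have b0 : b = 0.
  by apply: (mulfI nz2); rewrite mulr0 -[RHS](subrr (1 * b + 0 * d)) -{2}eb; ring.
have c0 : c = 0.
  by apply: (mulfI nz2); rewrite mulr0 -[RHS](subrr (c * 1 + d * 0)) {2}ec; ring.
rewrite b0 c0 in BX a2 d2.
have /eqP : a ^+ 2 = 1 by rewrite -a2; ring.
have /eqP : d ^+ 2 = 1 by rewrite -d2; ring.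
rewrite !sqrf_eq1 => /orP[] /eqP d1 /orP[] /eqP a1; rewrite d1 a1 in BX.
- by case/eqP: X1; apply: Binj; rewrite BX -mx2_scalar mul1mx mulmx1.
- apply: Binj; rewrite mulmxA BX -mulmxA BY mulmxA scalar_mxC.
  by congr (_ *m _); rewrite mul_mx2 mx2_scalar; congr mx2; ring.
- by case/eqP: XY; apply: Binj; rewrite BX BY.
by case/eqP: XN1; apply: Binj; rewrite BX scalar_mxC mx2_scalar.
Qed.

(** The off-diagonal equations are [(a - d) b = 0] and [(a - d) c = 0]. If [a != d], then [X] is
    diagonal with entries of square 1, contrary to [X *m X != 1]. *)
Lemma mx2_inverted X : X *m mx2 1 0 0 (-1) *m X = mx2 1 0 0 (-1) -> X *m X != 1%:M ->
  exists a b c, X = mx2 a b c a /\ a ^+ 2 - b * c = 1.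
Proof.
have [a [b [c [d ->]]]] := mx2P X.
rewrite !mul_mx2 mx2_scalar => /mx2_inj[E1 E2 E3 E4] X2.
have [ad | nz_ad] := eqVneq a d.
  exists a, b, c; split; first by rewrite ad.
  by rewrite -E1; ring.
have {}nz_ad : a - d != 0 by rewrite subr_eq0.
have b0 : b = 0 by apply: (mulfI nz_ad); rewrite mulr0 -[RHS]E2; ring.
have c0 : c = 0 by apply: (mulfI nz_ad); rewrite mulr0 -[RHS]E3; ring.
case/eqP: X2; rewrite b0 c0; congr mx2; try ring.
  by rewrite -E1 b0 c0; ring.
by apply: oppr_inj; rewrite -E4 b0 c0; ring.
Qed.

End Matrices2.

(** * Dihedral linear groups *)

Lemma abelem_p2_coord (p : nat) (gT : finGroupType) (T : {group gT}) :
    prime p -> p.-abelem T -> #|T| = (p ^ 2)%N ->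
  exists phi : 'rV['F_p]_2 -> gT, [/\ injective phi,
    forall u v : 'rV['F_p]_2, phi (u + v)%R = phi u * phi v & phi @: [set: 'rV['F_p]_2] = T].
Proof.
move=> p_pr abelT oT.
have ntT : T :!=: 1 by rewrite -cardG_gt1 oT -{1}(expn0 p) ltn_exp2l ?prime_gt1.
have dimT : abelem_dim' T = 1%N.
  rewrite /abelem_dim' oT pdiv_pfactor // pfactorK //.
suff : exists phi : 'rV['F_p]_(abelem_dim' T).+1 -> gT, [/\ injective phi,
    forall u v : 'rV['F_p]__, phi (u + v)%R = phi u * phi v & phi @: [set: 'rV['F_p]__] = T].
  by rewrite dimT.
exists (rVabelem abelT ntT); split.
- exact: rVabelem_inj.
- exact: rVabelemD.
apply/setP=> t; apply/imsetP/idP=> [[v _ ->]|Tt]; first exact: mem_rVabelem.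
by exists (abelem_rV abelT ntT t); rewrite ?inE // abelem_rV_K.
Qed.

Lemma additive_group_set (p : nat) (gT : finGroupType) (phi : 'rV['F_p]_2 -> gT) :
    (forall u v : 'rV['F_p]_2, phi (u + v)%R = phi u * phi v) ->
  group_set (phi @: [set: 'rV['F_p]_2]).
Proof.
move=> phiD; have phi0 : phi 0%R = 1.
  by apply: (mulgI (phi 0%R)); rewrite -phiD addr0 mulg1.
apply/group_setP; split; first by apply/imsetP; exists 0%R; rewrite ?inE.
move=> _ _ /imsetP[u _ ->] /imsetP[v _ ->].
by apply/imsetP; exists (u + v)%R; rewrite ?inE.
Qed.

Section Classification.

Variables (p n : nat) (gT : finGroupType) (G T H : {group gT}) (x y : gT).
Local Notation F := 'F_p.
Local Notation V := 'rV[F]_2.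
Hypotheses (p_pr : prime p) (odd_p : odd p).
Hypotheses (sdG : T ><| H = G) (cH1 : 'C_H(T) = 1).
Hypotheses (n_gt1 : 1 < n) (defH : H = <[x]> <*> <[y]> :> {set gT}).
Hypotheses (oH : #|H| = (2 * n)%N) (ox : #[x] = n) (y2 : y ^+ 2 = 1) (xy : x ^ y = x^-1).

(** Over the prime field, such a map amounts to a choice of basis of [T]. *)
Definition coords (phi : V -> gT) := [/\ injective phi,
    forall u v : V, phi (u + v)%R = phi u * phi v & phi @: [set: V] = T].

Let Hx : x \in H. Proof. by rewrite defH mem_gen // inE cycle_id. Qed.
Let Hy : y \in H. Proof. by rewrite defH mem_gen // inE cycle_id orbT. Qed.
Let nTH : H \subset 'N(T). Proof. by case/sdprodP: sdG. Qed.
Let nz2 : (2%:R != 0 :> F)%R.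
Proof.
rewrite -(dvdn_pcharf (pchar_Fp p_pr)) dvdn_prime2 //.
by apply: contraTneq odd_p => ->.
Qed.
Let nyX : y \notin <[x]>.
Proof.
apply/negP=> Xy; have : H \subset <[x]> by rewrite defH join_subG subxx cycle_subG.
by move/subset_leq_card; rewrite oH -orderE ox leqNgt mul2n -addnn -{1}[n]addn0 ltn_add2l ltnW.
Qed.

Lemma coords_base_change (phi : V -> gT) (B : 'M[F]_2) : B \in unitmx -> coords phi ->
  coords (fun v => phi (v *m B)%R).
Proof.
move=> uB [inj phiD im]; split.
- by move=> u v /inj/(can_inj (mulmxK uB)).
- by move=> u v; rewrite mulmxDl phiD.
rewrite -im; apply/setP=> t; apply/imsetP/imsetP=> -[v _ ->].
  by exists (v *m B)%R.
by exists (v *m invmx B)%R; rewrite ?inE // mulmxKV.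
Qed.

Lemma acts_by_base_change (phi : V -> gT) (A A' B : 'M[F]_2) h : (B *m A = A' *m B)%R ->
  acts_by phi h A -> acts_by (fun v => phi (v *m B)%R) h A'.
Proof. by move=> BA hA v; rewrite hA -!mulmxA BA. Qed.

Lemma acts_byX (phi : V -> gT) h (A : 'M[F]_2) k :
  acts_by phi h A -> acts_by phi (h ^+ k) (A ^+ k)%R.
Proof.
move=> hA; elim: k => [|k IHk].
  by rewrite expg0 expr0; move=> v; rewrite conjg1 -[1%R]/(1%:M)%R mulmx1.
by rewrite expgS exprS -mulmxE; apply: acts_byM.
Qed.

Lemma acts_by_eq1 (phi : V -> gT) h (A : 'M[F]_2) : coords phi -> h \in H -> acts_by phi h A ->
  (h == 1) = (A == 1%:M)%R.
Proof.
case=> inj phiD im Hh hA; apply/eqP/eqP=> [h1 | A1].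
  by apply: acts_by_inj inj _ _ _ hA _; rewrite h1; apply: acts_by1.
apply/set1gP; rewrite -cH1 inE Hh; apply/centP=> t; rewrite -im.
case/imsetP=> v _ ->; apply/commute_sym/commgP/conjg_fixP.
by rewrite hA A1 mulmx1.
Qed.

Lemma acts_by_order (phi : V -> gT) (X : 'M[F]_2) k : coords phi -> acts_by phi x X ->
  (n %| k) = (X ^+ k == 1)%R.
Proof.
move=> co hX; rewrite -ox order_dvdn.
by rewrite (acts_by_eq1 co (groupX k Hx) (acts_byX k hX)).
Qed.

Lemma acts_by_has_order (phi : V -> gT) (X : 'M[F]_2) :
  coords phi -> acts_by phi x X -> has_order X n.
Proof.
move=> co hX; split; first exact: ltnW.
have ord k := acts_by_order k co hX.
split; first by apply/eqP; rewrite -ord.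
move=> k /andP[k_gt0 k_lt]; rewrite -ord; apply/negP=> /(dvdn_leq k_gt0).
by rewrite leqNgt k_lt.
Qed.

Lemma isog_affine2 (phi : V -> gT) (B A1 A2 M1 M2 : 'M[F]_2) h1 h2 :
    coords phi -> B \in unitmx -> <<[set h1; h2]>> = H ->
    acts_by phi h1 M1 -> acts_by phi h2 M2 ->
    (B *m M1 = A1 *m B)%R -> (B *m M2 = A2 *m B)%R ->
  G \isog affine_gen p [:: A1; A2].
Proof.
move=> co uB gen h1M h2M E1 E2.
have [inj phiD im] := coords_base_change uB co.
have h1A := acts_by_base_change E1 h1M; have h2A := acts_by_base_change E2 h2M.
apply: (isog_affine_gen sdG cH1 inj phiD im gen).
  move=> h /set2P[] ->; first by exists A1; rewrite ?inE ?eqxx.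
  by exists A2; rewrite ?inE ?eqxx ?orbT.
move=> A; rewrite !inE => /orP[] /eqP->.
  by exists h1; rewrite // -gen mem_gen ?set21.
by exists h2; rewrite // -gen mem_gen ?set22.
Qed.

Lemma isog_affine3 (phi : V -> gT) (B A1 A2 A3 M1 M2 M3 : 'M[F]_2) h1 h2 h3 :
    coords phi -> B \in unitmx -> <<[set h1; h2; h3]>> = H ->
    acts_by phi h1 M1 -> acts_by phi h2 M2 -> acts_by phi h3 M3 ->
    (B *m M1 = A1 *m B)%R -> (B *m M2 = A2 *m B)%R -> (B *m M3 = A3 *m B)%R ->
  G \isog affine_gen p [:: A1; A2; A3].
Proof.
move=> co uB gen h1M h2M h3M E1 E2 E3.
have [inj phiD im] := coords_base_change uB co.
have h1A := acts_by_base_change E1 h1M; have h2A := acts_by_base_change E2 h2M.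
have h3A := acts_by_base_change E3 h3M.
apply: (isog_affine_gen sdG cH1 inj phiD im gen).
  move=> h; rewrite !inE => /orP[/orP[] | ] /eqP->.
  - by exists A1; rewrite ?inE ?eqxx.
  - by exists A2; rewrite ?inE ?eqxx ?orbT.
  by exists A3; rewrite ?inE ?eqxx ?orbT.
move=> A; rewrite !inE => /or3P[] /eqP->.
- by exists h1; rewrite // -gen mem_gen // !inE eqxx.
- by exists h2; rewrite // -gen mem_gen // !inE eqxx orbT.
by exists h3; rewrite // -gen mem_gen // !inE eqxx !orbT.
Qed.

(** * The individual dihedral linear groups *)

Let gen_xy : <<[set x; y]>> = H.
Proof. by rewrite defH joing_idl joing_idr. Qed.

(** One of [x], [y], [x * y] acts as -1. It serves as the first generator, and a different
    involution is diagonalised as the second. *)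
Lemma stab_klein (phi : V -> gT) : coords phi -> n = 2 ->
  G \isog affine_gen p [:: mx2 (-1) 0 0 (-1); mx2 1 0 0 (-1)].
Proof.
move=> co n2; have [inj phiD im] := co.
have [X hX] := acts_by_exists inj phiD im (subsetP nTH x Hx).
have [Y hY] := acts_by_exists inj phiD im (subsetP nTH y Hy).
have x2 : x ^+ 2 = 1 by apply/eqP; rewrite -order_dvdn ox n2.
have cxy : commute x y.
  by apply/commgP/conjg_fixP; rewrite xy; apply: (mulgI x); rewrite mulgV -expg2 x2.
have YY : (Y *m Y = 1%:M)%R.
  by apply/eqP; rewrite -(acts_by_eq1 co (groupM Hy Hy) (acts_byM hY hY)) -expg2 y2.
have XX : (X *m X = 1%:M)%R.
  by apply/eqP; rewrite -(acts_by_eq1 co (groupM Hx Hx) (acts_byM hX hX)) -expg2 x2.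
have X1 : (X != 1%:M)%R by rewrite -(acts_by_eq1 co Hx hX) -order_eq1 ox n2.
have Y1 : (Y != 1%:M)%R.
  by rewrite -(acts_by_eq1 co Hy hY); apply: contraNneq nyX => ->.
have XY : X != Y.
  apply: contraNneq nyX => XY; have /eqP := XX; rewrite {2}XY.
  rewrite -(acts_by_eq1 co (groupM Hx Hy) (acts_byM hX hY)) -eq_invg_mul => /eqP <-.
  by rewrite groupV cycle_id.
have scal B : (B *m (-1)%:M = mx2 (-1) 0 0 (-1) *m B :> 'M[F]_2)%R.
  by rewrite -mx2_scalar scalar_mxC.
have [XN1 | XN1] := eqVneq X ((-1)%:M)%R.
  have [|B uB BY] := mx2_involution nz2 YY Y1; first by rewrite eq_sym -XN1.
  apply: (isog_affine2 co uB gen_xy hX hY) => //.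
  by rewrite XN1 scal.
have [YN1 | YN1] := eqVneq Y ((-1)%:M)%R.
  have [B uB BX] := mx2_involution nz2 XX X1 XN1.
  apply: (isog_affine2 co uB _ hY hX) => //; last by rewrite YN1 scal.
  by rewrite setUC.
have [B uB BY] := mx2_involution nz2 YY Y1 YN1.
have gen : <<[set x * y; y]>> = H.
  apply/eqP; rewrite eqEsubset -{2}gen_xy !gen_subG !subUset !sub1set !groupM //= Hy.
  by rewrite -{1}(mulgK y x) groupM ?groupV ?mem_gen ?set21 ?set22.
apply: (isog_affine2 co uB gen (acts_byM hX hY) hY) => //.
suff -> : (X *m Y = (-1)%:M)%R by apply: scal.
apply: mx2_commuting_involutions => //.
apply: acts_by_inj inj _ _ _ (acts_byM hX hY) _.
by rewrite cxy; apply: acts_byM.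
Qed.

(** In an eigenbasis of [y], the relation [x * y * x = y] and the fact that [x] has order above 2
    give the shape of [x]. *)
Lemma stab_normal_form (phi0 : V -> gT) : coords phi0 -> 2 < n ->
  exists (phi : V -> gT) (a b c : F), [/\ coords phi, acts_by phi x (mx2 a b c a),
    acts_by phi y (mx2 1 0 0 (-1)) & (a ^+ 2 - b * c = 1)%R].
Proof.
move=> co n_gt2; have [inj phiD im] := co.
have [X hX] := acts_by_exists inj phiD im (subsetP nTH x Hx).
have [Y hY] := acts_by_exists inj phiD im (subsetP nTH y Hy).
have YY : (Y *m Y = 1%:M)%R.
  by apply/eqP; rewrite -(acts_by_eq1 co (groupM Hy Hy) (acts_byM hY hY)) -expg2 y2.
have XX : (X *m X != 1%:M)%R.
  rewrite mulmxE -expr2 -[1%:M%R]/(1%R) -(acts_by_order 2 co hX).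
  by apply/negP=> /(dvdn_leq (isT : 0 < 2)); rewrite leqNgt n_gt2.
have xyx : x * y * x = y by rewrite {1}(conjgC x) xy mulgKV.
have XYX : (X *m Y *m X = Y)%R.
  by apply: acts_by_inj inj _ _ _ (acts_byM (acts_byM hX hY) hX) _; rewrite xyx.
have Y1 : Y != 1%:M%R.
  by apply: contraNneq XX => Y1; move: XYX; rewrite Y1 mulmx1 => ->.
have YN1 : Y != (-1)%:M%R.
  apply: contraNneq XX => YN1; apply/eqP/oppr_inj.
  by move: XYX; rewrite YN1 raddfN /= mulmxN mulmx1 mulNmx.
have [B uB BY] := mx2_involution nz2 YY Y1 YN1.
have Binj : injective (mulmx B : 'M[F]_2 -> 'M[F]_2) := can_inj (mulKmx uB).
have [X' BX] : exists X', (B *m X = X' *m B)%R.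
  by exists (B *m X *m invmx B)%R; rewrite mulmxKV.
have [| | a [b [c [defX' det1]]]] := @mx2_inverted _ X'.
- apply: (can_inj (mulmxK uB)).
  have -> : (mx2 1 0 0 (-1) *m B = B *m (X *m Y *m X))%R by rewrite XYX BY.
  rewrite -[LHS]mulmxA -[in LHS]BX [LHS]mulmxA.
  by rewrite !mulmxA BX -(mulmxA X' B Y) BY mulmxA.
- apply: contraNneq XX => X'1; apply/eqP/Binj.
  by rewrite mulmxA BX -mulmxA BX mulmxA X'1 mul1mx mulmx1.
exists (fun v => phi0 (v *m B)%R), a, b, c; split=> //.
- exact: coords_base_change.
- by apply: acts_by_base_change hX; rewrite BX defX'.
- exact: acts_by_base_change hY.
Qed.

Let pF : p \in [pchar F]%R. Proof. exact: pchar_Fp. Qed.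

(** Here [y] fixes pointwise the line centralised by [x]; exchanging the axes and rescaling by [c]
    gives the fifth group. *)
Lemma stab_lower (phi : V -> gT) (c : F) : coords phi -> (c != 0)%R ->
    acts_by phi x (mx2 1 0 c 1) -> acts_by phi y (mx2 1 0 0 (-1)) ->
  n = p /\ G \isog affine_gen p [:: mx2 1 1 0 1; mx2 (-1) 0 0 1].
Proof.
move=> co nz_c hX hY; split.
  have : n %| p.
    by rewrite (acts_by_order _ co hX) expr_mx2_lower mulrn_pchar // -mx2_scalar.
  by case/primeP: p_pr => _ dv_p /dv_p/pred2P[n1|//]; move: n_gt1; rewrite n1.
apply: (@isog_affine2 phi (mx2 0 1 c 0) _ _ _ _ _ _ co _ gen_xy hX hY).
- by apply: mx2_unit; rewrite mul0r sub0r mul1r oppr_eq0.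
- by rewrite !mul_mx2; congr mx2; ring.
by rewrite !mul_mx2; congr mx2; ring.
Qed.

(** [n] divides [2 * p] but not [p], so it is even, and [n > 2] excludes [n = 2]. *)
Lemma stab_order_double (phi : V -> gT) (X : 'M[F]_2) : coords phi -> 2 < n ->
  acts_by phi x X -> (X ^+ p = -1)%R -> n = (2 * p)%N.
Proof.
move=> co n_gt2 hX Xp.
have n_2p : n %| 2 * p.
  by rewrite (acts_by_order _ co hX) mulnC exprM Xp sqrrN expr1n.
have n'p : ~~ (n %| p).
  by rewrite (acts_by_order _ co hX) Xp; apply: mx2_oppr1_neq1.
have [odd_n | even_n] := boolP (odd n).
  by rewrite Gauss_dvdr ?coprimen2 ?(negPf n'p) in n_2p.
have [m defn] : exists m, n = (2 * m)%N by exists n./2; rewrite mul2n even_halfK.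
rewrite defn dvdn_pmul2l // in n_2p; rewrite defn; congr (2 * _)%N.
case/primeP: p_pr => _ dv_p; case/pred2P: (dv_p _ n_2p) => // m1.
by rewrite defn m1 in n_gt2.
Qed.

Lemma scal_N1_mx2 (B : 'M[F]_2) : (B *m (-1) = mx2 (-1) 0 0 (-1) *m B)%R.
Proof. by rewrite mulmxN mulmx1 -[mx2 (-1) 0 0 (-1)]mx2_scalar raddfN /= mulNmx mul1mx. Qed.

(** [x] acts as minus a unipotent matrix, so [x ^+ p] acts as -1 and [x ^+ p.+1] is the unipotent
    generator. *)
Lemma stab_neg_upper (phi : V -> gT) (b : F) : coords phi -> 2 < n -> (b != 0)%R ->
    acts_by phi x (mx2 (-1) b 0 (-1)) -> acts_by phi y (mx2 1 0 0 (-1)) ->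
  n = (2 * p)%N /\
  G \isog affine_gen p [:: mx2 1 1 0 1; mx2 (-1) 0 0 (-1); mx2 1 0 0 (-1)].
Proof.
move=> co n_gt2 nz_b hX hY.
have Xp : (mx2 (-1) b 0 (-1) ^+ p = -1 :> 'M[F]_2)%R.
  have -> : (mx2 (-1) b 0 (-1) = - mx2 1 (- b) 0 1 :> 'M[F]_2)%R.
    by rewrite mx2N; congr mx2; rewrite ?opprK ?oppr0.
  by rewrite exprNn expr_mx2_upper mulrn_pchar // -mx2_scalar -signr_odd odd_p mulN1r.
split; first exact: stab_order_double hX Xp.
have hXp := acts_byX p hX; have hXp1 := acts_byX p.+1 hX.
rewrite exprS Xp mulrN1 mx2N opprK in hXp1; rewrite Xp in hXp.
apply: (@isog_affine3 phi (mx2 1 0 0 (- b)) _ _ _ _ _ _ _ _ _ co _ _ hXp1 hXp hY).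
- by apply: mx2_unit; rewrite mul0r subr0 mul1r oppr_eq0.
- apply/eqP; rewrite eqEsubset -{2}gen_xy !gen_subG !subUset !sub1set !groupX //= Hy.
  rewrite -{1}[x](mulgK (x ^+ p)) -expgS groupM ?groupV ?mem_gen //;
    by rewrite !inE eqxx ?orbT.
- by rewrite !mul_mx2; congr mx2; ring.
- exact: scal_N1_mx2.
by rewrite !mul_mx2; congr mx2; ring.
Qed.

(** As [-1] is available, [x ^+ p * y], acting as minus the matrix of [y], replaces [y]; exchanging
    the axes then leads to the same group as in the upper triangular case. *)
Lemma stab_neg_lower (phi : V -> gT) (c : F) : coords phi -> 2 < n -> (c != 0)%R ->
    acts_by phi x (mx2 (-1) 0 c (-1)) -> acts_by phi y (mx2 1 0 0 (-1)) ->
  n = (2 * p)%N /\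
  G \isog affine_gen p [:: mx2 1 1 0 1; mx2 (-1) 0 0 (-1); mx2 1 0 0 (-1)].
Proof.
move=> co n_gt2 nz_c hX hY.
have Xp : (mx2 (-1) 0 c (-1) ^+ p = -1 :> 'M[F]_2)%R.
  have -> : (mx2 (-1) 0 c (-1) = - mx2 1 0 (- c) 1 :> 'M[F]_2)%R.
    by rewrite mx2N; congr mx2; rewrite ?opprK ?oppr0.
  by rewrite exprNn expr_mx2_lower mulrn_pchar // -mx2_scalar -signr_odd odd_p mulN1r.
split; first exact: stab_order_double hX Xp.
have hXp := acts_byX p hX; have hXp1 := acts_byX p.+1 hX.
rewrite exprS Xp mulrN1 mx2N opprK in hXp1; rewrite Xp in hXp.
have hXpY := acts_byM hXp hY; rewrite mulNmx mul1mx mx2N in hXpY.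
apply: (@isog_affine3 phi (mx2 0 1 (- c) 0) _ _ _ _ _ _ _ _ _ co _ _ hXp1 hXp hXpY).
- by apply: mx2_unit; rewrite mul0r sub0r mul1r opprK.
- apply/eqP; rewrite eqEsubset -{2}gen_xy !gen_subG !subUset !sub1set !groupM ?groupX //=.
  apply/andP; split.
    by rewrite -{1}[x](mulgK (x ^+ p)) -expgS groupM ?groupV ?mem_gen // !inE eqxx ?orbT.
  by rewrite -{1}[y](mulKg (x ^+ p)) groupM ?groupV ?mem_gen // !inE eqxx ?orbT.
- by rewrite !mul_mx2; congr mx2; ring.
- exact: scal_N1_mx2.
by rewrite !mul_mx2; congr mx2; ring.
Qed.

Lemma expf_pred (t : F) : (t != 0 -> t ^+ p.-1 = 1)%R.
Proof.
move=> nz_t; apply: (mulfI nz_t); rewrite mulr1 -exprS prednK ?prime_gt0 //.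
by have := expf_card t; rewrite card_Fp.
Qed.

(** [x] has the eigenvalues [a + s] and [a - s], with product 1. The rows [(c, s)] and [(c, -s)] of
    [B] are left eigenvectors, and [y] exchanges them. *)
Lemma stab_split (phi : V -> gT) (a b c s : F) :
    coords phi -> (s != 0)%R -> (b * c = s ^+ 2)%R -> (a ^+ 2 - b * c = 1)%R ->
    acts_by phi x (mx2 a b c a) -> acts_by phi y (mx2 1 0 0 (-1)) ->
  n %| p.-1 /\ exists t : F, [/\ (t != 0)%R, has_order t n &
    G \isog affine_gen p [:: mx2 t 0 0 t^-1; mx2 0 1 1 0]].
Proof.
move=> co nz_s bc det hX hY.
have tt' : ((a + s) * (a - s) = 1)%R by rewrite -det bc; ring.
have nz_t : (a + s != 0)%R.
  by apply/eqP=> t0; move/eqP: tt'; rewrite t0 mul0r eq_sym oner_eq0.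
have tV : ((a + s)^-1 = a - s)%R by apply: (mulfI nz_t); rewrite divff.
have nz_c : (c != 0)%R.
  by apply: contraNneq nz_s => c0; rewrite -sqrf_eq0 -bc c0 mulr0.
pose B : 'M[F]_2 := mx2 c s c (- s).
have uB : B \in unitmx.
  apply: mx2_unit; rewrite (_ : _ - _ = - (2%:R * (c * s)))%R ?oppr_eq0 ?mulf_neq0 //.
  ring.
have BX : (B *m mx2 a b c a = mx2 (a + s) 0 0 (a + s)^-1 *m B)%R.
  rewrite tV !mul_mx2; congr mx2; try ring.
    by rewrite [(c * b)%R]mulrC bc; ring.
  by rewrite [(c * b)%R]mulrC bc; ring.
have hX' := acts_by_base_change BX hX.
have co' := coords_base_change uB co.
have ord k : (n %| k) = ((a + s) ^+ k == 1)%R.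
  rewrite (acts_by_order k co' hX') expr_mx2_diag -[1%R in LHS]/(1%:M)%R mx2_scalar.
  apply/eqP/eqP=> [/mx2_inj[] // | tk]; by rewrite exprVn tk invr1.
split; first by rewrite ord expf_pred.
exists (a + s)%R; split=> //.
  split; first exact: ltnW.
  split; first by apply/eqP; rewrite -ord.
  move=> k /andP[k_gt0 k_lt]; rewrite -ord; apply/negP=> /(dvdn_leq k_gt0).
  by rewrite leqNgt k_lt.
apply: (isog_affine2 co uB gen_xy hX hY BX).
by rewrite !mul_mx2; congr mx2; ring.
Qed.

(** The square of this power is 1. If the power itself were 1, [theta] would have at most [p.-1./2]
    distinct powers, too few for all nonzero elements. *)
Lemma generator_expr_half (theta : F) :
    (forall z : F, z != 0%R -> exists k : nat, z = (theta ^+ k)%R) ->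
  (theta ^+ p.-1./2 = -1)%R.
Proof.
move=> gen_theta; set h := p.-1./2.
have p_gt0 := prime_gt0 p_pr.
have h2 : p.-1 = (2 * h)%N.
  by rewrite mul2n even_halfK //; move: odd_p; rewrite -{1}(prednK p_gt0).
have h_gt0 : 0 < h.
  by rewrite lt0n; apply: contraTneq (prime_gt1 p_pr) => h0; rewrite -(prednK p_gt0) h2 h0.
have nz_theta : theta != 0%R.
  apply: contraNneq nz2 => th0; have [|k] := gen_theta (-1)%R; first by rewrite oppr_eq0 oner_eq0.
  rewrite th0; case: k => [|k]; rewrite ?expr0 ?exprS ?mul0r => /eqP.
    by rewrite eq_sym -subr_eq0 opprK.
  by rewrite oppr_eq0 oner_eq0.
have /eqP : ((theta ^+ h) ^+ 2 = 1)%R by rewrite -exprM mulnC -h2 expf_pred.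
rewrite sqrf_eq1 => /orP[/eqP th1 | /eqP //].
suff : p.-1 <= h by rewrite h2 leqNgt -{1}[h]mul1n ltn_pmul2r.
rewrite -{1}(card_Fp p_pr) -(cardsC1 0%R) -[X in _ <= X]card_ord -cardsT.
apply: leq_trans (leq_imset_card (fun i : 'I_h => theta ^+ i)%R _).
apply/subset_leq_card/subsetP=> z; rewrite !inE => /gen_theta[k ->].
by apply/imsetP; exists (Ordinal (ltn_pmod k h_gt0)); rewrite ?inE //= expr_mod.
Qed.

Lemma stab_nonsplit (phi : V -> gT) (theta a b c : F) :
    (forall z : F, z != 0%R -> exists k : nat, z = (theta ^+ k)%R) ->
    coords phi -> (forall s : F, b * c != s ^+ 2)%R -> (a ^+ 2 - b * c = 1)%R ->
    acts_by phi x (mx2 a b c a) -> acts_by phi y (mx2 1 0 0 (-1)) ->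
  n %| p.+1 /\ exists e f : F, [/\ (e ^+ 2 - f ^+ 2 * theta = 1)%R,
    has_order (mx2 e (f * theta) f e)%R n &
    G \isog affine_gen p [:: mx2 e (f * theta) f e; mx2 1 0 0 (-1)]].
Proof.
move=> gen_theta co nsq det hX hY.
have nz_bc : (b * c != 0)%R by have := nsq 0%R; rewrite expr0n.
have [b_nz c_nz] : (b != 0)%R /\ (c != 0)%R by apply/andP; rewrite -negb_or -mulf_eq0.
(* The nonsquare [b * c] is an odd power of [theta]; [f] is [theta] to half the exponent, rounded
   down. *)
have [f bc] : exists f : F, (b * c = f ^+ 2 * theta)%R.
  have [k defk] := gen_theta _ nz_bc; exists (theta ^+ k./2)%R.
  have := odd_double_half k; case: (odd k) => [|] defk2.
    by rewrite defk -{1}defk2 add1n exprSr -exprM muln2.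
  by case/eqP: (nsq (theta ^+ k./2)%R); rewrite defk -{1}defk2 add0n -exprM muln2.
have f_nz : (f != 0)%R by apply: contraNneq nz_bc => f0; rewrite bc f0 expr0n mul0r.
pose B : 'M[F]_2 := mx2 c 0 0 f.
have uB : B \in unitmx by apply: mx2_unit; rewrite mul0r subr0 mulf_neq0.
have BX : (B *m mx2 a b c a = mx2 a (f * theta) f a *m B)%R.
  rewrite !mul_mx2; congr mx2; try ring.
  by rewrite mul0r addr0 mulrC bc; ring.
have hX' := acts_by_base_change BX hX.
have co' := coords_base_change uB co.
rewrite bc in det.
split; last first.
  exists a, f; split=> //; first exact: acts_by_has_order hX'.
  apply: (isog_affine2 co uB gen_xy hX hY BX).
  by rewrite !mul_mx2; congr mx2; ring.
(* The [p]-th power of the matrix is its conjugate, which is its inverse because the determinant is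
   1. *)
rewrite (acts_by_order _ co' hX') exprS.
suff -> : (mx2 a (f * theta) f a ^+ p = mx2 a (- (f * theta)) (- f) a :> 'M[F]_2)%R.
  rewrite -mulmxE mul_mx2 -[1%R in X in _ == X]/(1%:M)%R mx2_scalar; apply/eqP.
  by congr mx2; try ring; rewrite -det; ring.
have exp_p (z : F) : (z ^+ p = z)%R by have := expf_card z; rewrite card_Fp.
by apply: mx2_Frobenius => //; apply: generator_expr_half.
Qed.

(* Here [y] inverts the line of [T] centralised by [x], and [G] is not conjugate in
   [AGL(2,p)] to any listed group with dihedral linear part. But the complement
   [<t, y>], cyclic of order [2p], of the other elementary abelian normal subgroup
   [<x, phi (0, 1)>] exhibits [G] as the seventh group. *)
Lemma stab_upper (phi : V -> gT) (b : F) : coords phi -> (b != 0)%R ->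
    acts_by phi x (mx2 1 b 0 1) -> acts_by phi y (mx2 1 0 0 (-1)) ->
  n = p /\ G \isog affine_gen p [:: mx2 1 1 0 1; mx2 (-1) 0 0 (-1)].
Proof.
move=> co nz_b hX hY.
have np : n = p.
  have : n %| p.
    by rewrite (acts_by_order _ co hX) expr_mx2_upper mulrn_pchar // -mx2_scalar.
  by case/primeP: p_pr => _ dv_p /dv_p/pred2P[n1|//]; move: n_gt1; rewrite n1.
split=> //; have [inj phiD im] := co.
have phiT v : phi v \in T by rewrite -im imset_f.
have phi0 : phi 0%R = 1 by apply: (mulgI (phi 0%R)); rewrite -phiD addr0 mulg1.
have phiX (v : V) k : phi (v *+ k)%R = phi v ^+ k.
  by elim: k => [|k IHk]; rewrite ?mulr0n ?phi0 // mulrS phiD expgS IHk.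
have phiC u v : commute (phi u) (phi v) by rewrite /commute -!phiD addrC.
have [_ _ _ tiTH] := sdprodP sdG.
have xp1 : x ^+ p = 1 by rewrite -np -ox expg_order.
have hXE (u v : F) : phi (rv2 u v) ^ x = phi (rv2 u (u * b + v))%R.
  by rewrite hX mul_rv2_mx2; congr (phi (rv2 _ _)); ring.
have hYE (u v : F) : phi (rv2 u v) ^ y = phi (rv2 u (- v))%R.
  by rewrite hY mul_rv2_mx2; congr (phi (rv2 _ _)); ring.
(* [phi'] below gives coordinates on the second normal subgroup; [xp], which uses natural
   representatives as exponents, is additive because [x ^+ p = 1]. *)
pose z (u : F) := phi (rv2 0 u); pose xp (u : F) := x ^+ u.
have xpD (u v : F) : xp (u + v)%R = xp u * xp v.
  by rewrite /xp /= expg_mod ?expgD // Fp_cast.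
have xp0 : xp 0%R = 1 by [].
have zD (u v : F) : z (u + v)%R = z u * z v by rewrite /z -phiD rv2D addr0.
have z0 : z 0%R = 1.
  by apply: (mulgI (z 0%R)); rewrite -zD addr0 mulg1.
have cxz u v : commute (xp u) (z v).
  apply/commute_sym/commuteX/commgP/conjg_fixP; rewrite /z hXE.
  by congr (phi (rv2 _ _)); ring.
pose phi' (v : V) := xp (v 0 0)%R * z (v 0 1)%R.
have phi'E (u v : F) : phi' (rv2 u v) = xp u * z v by rewrite /phi' rv2_0 rv2_1.
have phi'D (u v : V) : phi' (u + v)%R = phi' u * phi' v.
  rewrite [u]rv2P [v]rv2P; move: (u _ _) (u _ _) (v _ _) (v _ _) => u0 u1 v0 v1.
  rewrite rv2D !phi'E xpD zD -!mulgA; congr (_ * _); rewrite !mulgA; congr (_ * _).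
  exact: cxz.
have xp_inj u : xp u = 1 -> u = 0%R.
  move/eqP; rewrite -order_dvdn ox np => p_u; apply: val_inj => /=.
  apply/eqP; rewrite -[_ == _]negbK -lt0n; apply/negP=> u_gt0.
  by have := dvdn_leq u_gt0 p_u; rewrite leqNgt -{2}(Fp_cast p_pr) ltn_ord.
have z_inj u : z u = 1 -> u = 0%R.
  by rewrite -phi0 => /inj/rowP/(_ 1%R); rewrite !mxE.
have phi'_inj : injective phi'.
  have ker v : phi' v = 1 -> v = 0%R.
    rewrite [v]rv2P phi'E; move: (v _ _) (v _ _) => w u E1.
    have xpu1 : xp u = 1.
      apply/set1gP; rewrite -tiTH inE; apply/andP; split; last by rewrite groupX.
      by rewrite -(mulgK (z w) (xp u)) E1 mul1g groupV phiT.
    rewrite xpu1 mul1g in E1; rewrite (xp_inj _ xpu1) (z_inj _ E1).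
    by apply/rowP=> i; rewrite !mxE; case: ifP.
  have phi'0 : phi' 0%R = 1 by apply: (mulgI (phi' 0%R)); rewrite -phi'D addr0 mulg1.
  move=> u v E1; apply/eqP; rewrite -subr_eq0; apply/eqP/ker.
  by rewrite phi'D E1 -phi'D subrr.
pose T' := Group (additive_group_set phi'D).
have phi'T v : phi' v \in T' by rewrite /= imset_f.
(* The entry [- b^-1] makes the commutator of [x] with [t] equal to [z 1]. *)
pose t := phi (rv2 (- b^-1) 0)%R.
have xt : x ^ t = x * z 1%R.
  rewrite conjgE mulgA (conjgC t^-1 x) -mulgA conjVg; congr (_ * _).
  apply: (canLR (mulKg _)); rewrite /t hXE /z -phiD rv2D; congr (phi (rv2 _ _)).
    by rewrite addr0.
  by rewrite mulNr mulVf // addr0 addNr.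
have zX (u : F) : z 1%R ^+ u = z u.
  have zXn k : z 1%R ^+ k = z k%:R%R.
    by elim: k => [|k IHk]; rewrite ?z0 // expgS IHk -zD mulrS.
  by rewrite zXn natr_Zp.
have tact : acts_by phi' t (mx2 1 1 0 1).
  move=> v; rewrite [v]rv2P; move: (v _ _) (v _ _) => w u.
  rewrite mul_rv2_mx2 !phi'E conjMg conjXg xt expgMn; last first.
    by have := cxz 1%R 1%R; rewrite /xp expg1.
  have -> : z w ^ t = z w by apply/conjg_fixP/commgP/phiC.
  by rewrite zX -mulgA -zD !mulr1 mulr0 addr0.
have yact : acts_by phi' y (mx2 (-1) 0 0 (-1)).
  move=> v; rewrite [v]rv2P; move: (v _ _) (v _ _) => w u.
  rewrite mul_rv2_mx2 !phi'E conjMg conjXg xy /z hYE !mulr0 addr0 add0r !mulrN1.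
  congr (_ * _); rewrite expgVn -/(xp u); apply/eqP.
  by rewrite eq_invg_mul -xpD subrr.
have norm_acts g A : acts_by phi' g A -> g \in 'N(T').
  move=> gA; rewrite inE; apply/subsetP=> _ /imsetP[_ /imsetP[v _ ->] ->].
  by rewrite gA phi'T.
pose H' := (<[t]> <*> <[y]>)%G.
have nT'H' : H' \subset 'N(T').
  by rewrite join_subG !cycle_subG (norm_acts _ _ tact) (norm_acts _ _ yact).
have cty : commute t y.
  by apply/commgP/conjg_fixP; rewrite /t hYE oppr0.
have H'P h : h \in H' -> exists i j, h = t ^+ i * y ^+ j.
  rewrite /= cent_joinEr; last first.
    by rewrite cycle_subG /= cent_cycle; apply/cent1P/commute_sym.
  by case/mulsgP=> _ _ /cycleP[i ->] /cycleP[j ->] ->; exists i, j.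
have dblF (u : F) : (- u = u)%R -> u = 0%R.
  move/eqP; rewrite eq_sym -subr_eq0 opprK -mulr2n -mulr_natl mulf_eq0 (negPf nz2).
  by move/eqP.
(* Centralising [z 1] forces [y ^+ j = 1], as [y] inverts it and [t] fixes it; centralising [x] then
   forces [t ^+ i = 1]. *)
have cent1 : 'C_H'(T') = 1.
  apply/trivgP/subsetP=> h /setIP[/H'P[i [j ->]] /centP cTh].
  have phi'z (u : F) : phi' (rv2 0 u) = z u by rewrite phi'E xp0 mul1g.
  have phi'x : phi' (rv2 1 0) = x by rewrite phi'E z0 mulg1 /xp expg1.
  have zt : z 1%R ^ (t ^+ i) = z 1%R by apply/conjg_fixP/commgP/commuteX/phiC.
  have zh : z 1%R ^ (y ^+ j) = z 1%R.
    rewrite -{1}zt -conjgM; apply/conjg_fixP/commgP/commute_sym; apply: cTh.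
    by rewrite -phi'z phi'T.
  have yj : y ^+ j = y ^+ odd j.
    by rewrite -{1}(odd_double_half j) expgD -muln2 mulnC expgM y2 expg1n mulg1.
  have {}yj : y ^+ j = 1.
    rewrite yj in zh *; case: (odd j) zh => // /eqP.
    rewrite expg1 /z hYE => /eqP/inj/rowP/(_ 1%R); rewrite !mxE /=.
    by move/dblF/eqP; rewrite oner_eq0.
  rewrite yj mulg1 in cTh *.
  have tX k : t ^+ k = phi (rv2 ((- b^-1) *+ k) 0)%R.
    elim: k => [|k IHk]; first by rewrite -[LHS]z0.
    by rewrite expgS IHk -phiD rv2D mulrS addr0.
  have : t ^+ i ^ x = t ^+ i.
    by apply/conjg_fixP/commgP; apply: cTh; rewrite -phi'x phi'T.
  rewrite tX hXE => /inj/rowP/(_ 1%R); rewrite !mxE /= addr0 => /eqP.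
  by rewrite mulf_eq0 (negPf nz_b) orbF => /eqP->; rewrite inE -/(z 0%R) z0.
have sT'C : T' :&: H' \subset 'C_H'(T').
  rewrite setIC setIS //; apply/centsP=> _ /imsetP[u _ ->] _ /imsetP[v _ ->].
  by rewrite /commute -!phi'D addrC.
have tiT'H' : T' :&: H' = 1 by apply/trivgP; rewrite -cent1.
have [nsTG sHG _ _ _] := sdprod_context sdG; have sTG := normal_sub nsTG.
have oV : #|[set: V]| = (p ^ 2)%N by rewrite cardsT card_mx card_Fp.
have oT : #|T| = (p ^ 2)%N by rewrite -im card_imset.
have oT' : #|T'| = (p ^ 2)%N by rewrite /= card_imset.
(* This lower bound, from elements of the coprime orders [p] and 2, suffices to make [T' * H'] fill
   [G]. *)
have oH' : 2 * p <= #|H'|.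
  have ot : #[t] = p.
    apply: nt_prime_order => //.
      by rewrite -phiX -scaler_nat pcharf0 // scale0r phi0.
    rewrite -phi0; apply: contra nz_b => /eqP/inj/rowP/(_ 0%R); rewrite !mxE /=.
    by move/eqP; rewrite oppr_eq0 invr_eq0.
  have oy : #[y] = 2 by apply: nt_prime_order => //; apply: contraNneq nyX => ->.
  rewrite dvdn_leq ?cardG_gt0 // Gauss_dvd ?coprime2n // -{1}oy -ot !order_dvdG //.
    by rewrite mem_gen // inE cycle_id.
  by rewrite mem_gen // inE cycle_id orbT.
have sdG' : T' ><| H' = G.
  rewrite sdprodE //; apply/eqP; rewrite eqEcard; apply/andP; split.
    rewrite mul_subG //.
      apply/subsetP=> _ /imsetP[v _ ->]; apply: groupM; last exact/(subsetP sTG)/phiT.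
      exact/groupX/(subsetP sHG).
    by rewrite join_subG !cycle_subG (subsetP sTG) ?(subsetP sHG) ?phiT.
  by rewrite TI_cardMg // -(sdprod_card sdG) oT oT' oH np leq_mul2l oH' orbT.
apply: (isog_affine_gen sdG' cent1 phi'_inj phi'D (erefl _) (_ : <<[set t; y]>> = H')).
- by rewrite /= joing_idl joing_idr.
- move=> h /set2P[] ->; first by exists (mx2 1 1 0 1); rewrite ?inE ?eqxx.
  by exists (mx2 (-1) 0 0 (-1)); rewrite ?inE ?eqxx ?orbT.
move=> A; rewrite !inE => /orP[] /eqP->.
  by exists t; rewrite // mem_gen // inE cycle_id.
by exists y; rewrite // mem_gen // inE cycle_id orbT.
Qed.

End Classification.

(** * The case [p = 2] and the final case distinction *)

Lemma isog_perm_card (S1 S2 : finType) :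
  #|S1| = #|S2| -> [set: {perm S1}] \isog [set: {perm S2}].
Proof.
move=> eqS; pose f (i : S1) : S2 := enum_val (cast_ord eqS (enum_rank i)).
pose g (j : S2) : S1 := enum_val (cast_ord (esym eqS) (enum_rank j)).
have fK : cancel f g by move=> i; rewrite /f /g enum_valK cast_ordK enum_rankK.
have gK : cancel g f by move=> i; rewrite /f /g enum_valK cast_ordKV enum_rankK.
have inj (s : {perm S1}) : injective (fun j => f (s (g j))).
  by apply: inj_comp (can_inj fK) (inj_comp perm_inj (can_inj gK)).
pose F s := perm (inj s).
have FM : {in [set: {perm S1}] &, {morph F : s t / s * t}}.
  by move=> s t _ _; apply/permP=> j; rewrite !(permM, permE) fK.
have injF : 'injm (Morphism FM).
  apply/injmP=> s t _ _ /permP E; apply/permP=> i.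
  by have := E (f i); rewrite /= !permE fK => /(can_inj fK).
apply/isogP; exists (Morphism FM) => //; apply/eqP.
by rewrite eqEcard subsetT card_injm // !card_Sym eqS leqnn.
Qed.

(** The translations are transitive on 4 points and the stabiliser of 0 has elements of orders 3 and
    2, so the order is at least 24, that of the symmetric group. *)
Lemma affine_gen_F2 :
  affine_gen 2 [:: mx2 1 1 1 0; mx2 0 1 1 0] = [set: {perm 'rV['F_2]_2}].
Proof.
set A := affine_gen _ _.
have oV : #|{: 'rV['F_2]_2}| = 4 by rewrite card_mx card_Fp.
have oS : #|[set: {perm 'rV['F_2]_2}]| = 24 by rewrite card_Sym oV.
apply/eqP; rewrite eqEcard subsetT /= oS.
have trA a : trans_perm a \in A by rewrite mem_gen // inE imset_f.
have linA M : M \in [:: mx2 1 1 1 0; mx2 0 1 1 0] -> lin_perm M \in A.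
  by move=> LM; rewrite mem_gen // inE imset_f ?orbT.
set X : 'M['F_2]_2 := mx2 1 1 1 0; set Y : 'M['F_2]_2 := mx2 0 1 1 0.
have uX : X \in unitmx by apply: mx2_unit.
have uY : Y \in unitmx by apply: mx2_unit.
have XXX : (X *m X *m X = 1%:M)%R.
  by rewrite !mul_mx2 mx2_scalar; congr mx2; apply: val_inj.
have YY : (Y *m Y = 1%:M)%R.
  by rewrite !mul_mx2 mx2_scalar; congr mx2; apply: val_inj.
have lin1 : lin_perm 1%:M%R = 1 :> {perm 'rV['F_2]_2}.
  by apply/permP=> v; rewrite lin_permE ?unitmx1 // mulmx1 perm1.
have lin_n1 M : M \in unitmx -> M != 1%:M%R -> lin_perm M != 1 :> {perm 'rV['F_2]_2}.
  move=> uM; apply: contra => /eqP M1; apply/eqP/mulmx_ext=> v.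
  by rewrite -lin_permE // M1 perm1 mulmx1.
have oX : #[lin_perm X] = 3.
  apply: nt_prime_order => //.
    by rewrite !expgS expg0 mulg1 -!lin_permM ?unitmx_mul ?uX // mulmxA XXX.
  apply: lin_n1 => //; rewrite mx2_scalar; apply/eqP=> /mx2_inj[_ /eqP].
  by [].
have oY : #[lin_perm Y] = 2.
  apply: nt_prime_order => //.
    by rewrite !expgS expg0 mulg1 -!lin_permM // YY.
  apply: lin_n1 => //; rewrite mx2_scalar; apply/eqP=> /mx2_inj[/eqP].
  by [].
pose K := 'C_(<<A>>)[0%R : 'rV['F_2]_2 | 'P]%G.
have defA : <<A>> = A by rewrite /A /affine_gen genGid.
have fix0 M : M \in unitmx -> lin_perm M \in 'C[0%R : 'rV['F_2]_2 | 'P].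
  by move=> uM; apply/astab1P; rewrite /= apermE lin_permE // mul0mx.
have KX : lin_perm X \in K.
  by apply/setIP; split; [rewrite /= defA linA ?inE ?eqxx | apply: fix0].
have KY : lin_perm Y \in K.
  by apply/setIP; split; [rewrite /= defA linA ?inE ?eqxx ?orbT | apply: fix0].
have oK : 6 <= #|K|.
  rewrite dvdn_leq ?cardG_gt0 // -[6]/(3 * 2)%N Gauss_dvd //.
  by have := order_dvdG KX; have := order_dvdG KY; rewrite oX oY => -> ->.
have orb : orbit 'P <<A>> (0%R : 'rV['F_2]_2) = [set: _].
  apply/setP=> v; rewrite !inE; apply/orbitP; exists (trans_perm v); first by rewrite defA.
  by rewrite /= apermE trans_permE add0r.
have := card_orbit_stab 'P <<A>>%G (0%R : 'rV['F_2]_2); rewrite orb cardsT oV /= defA => <-.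
by rewrite -[24]/(4 * 6)%N leq_mul2l /= -defA.
Qed.

Theorem mainTheorem7 (p : nat) (theta : 'F_p) (Omega : finType)
  (G : {group {perm Omega}}) (n : nat) :
  prime p ->
  (* theta is a fixed generator of F_p^* *)
  (forall z : 'F_p, z != 0%R -> exists k : nat, z = (theta ^+ k)%R) ->
  #|Omega| = (p ^ 2)%N ->
  [transitive G, on [set: Omega] | 'P] ->
  (1 < n)%N ->
  (forall w : Omega, 'C_G[w | 'P] \isog 'D_(2 * n)) ->
  ([/\ p = 2%N, n = 3%N &
          G \isog affine_gen p [:: mx2 1 1 1 0; mx2 0 1 1 0]]) \/
      ([/\ (3 <= p)%N, (n %| p.+1)%N, (3 <= n)%N &
          exists e f : 'F_p,
            [/\ (e ^+ 2 - f ^+ 2 * theta = 1)%R,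
                has_order (mx2 e (f * theta) f e) n &
                G \isog affine_gen p [:: mx2 e (f * theta) f e; mx2 1 0 0 (-1)]]]) \/
      ([/\ (3 <= p)%N, (n %| p.-1)%N, (3 <= n)%N &
          exists t : 'F_p,
            [/\ t != 0%R, has_order t n &
                G \isog affine_gen p [:: mx2 t 0 0 t^-1; mx2 0 1 1 0]]]) \/
      ([/\ (3 <= p)%N, n = 2%N &
          G \isog affine_gen p [:: mx2 (-1) 0 0 (-1); mx2 1 0 0 (-1)]]) \/
      ([/\ (3 <= p)%N, n = p &
          G \isog affine_gen p [:: mx2 1 1 0 1; mx2 (-1) 0 0 1]]) \/
      ([/\ (3 <= p)%N, n = (2 * p)%N &
          G \isog affine_gen p [:: mx2 1 1 0 1; mx2 (-1) 0 0 (-1); mx2 1 0 0 (-1)]]) \/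
      ([/\ (3 <= p)%N, n = p &
          G \isog affine_gen p [:: mx2 1 1 0 1; mx2 (-1) 0 0 (-1)]]).
Proof.
move=> p_pr gen_theta oOmega trG n_gt1 stabG.
have /card_gt0P[w _] : 0 < #|Omega| by rewrite oOmega expn_gt0 prime_gt0.
pose H := 'C_G[w | 'P]%G.
have isoH : H \isog 'D_(2 * n) := stabG w.
have sHG : H \subset G by apply: subsetIl.
have oGH : #|G : H| = (p ^ 2)%N.
  by rewrite -card_orbit (atransP trG) ?inE // cardsT.
have [x [y [defH oH ox y2 xy]]] := dihedral_generators n_gt1 isoH.
have [odd_p | even_p] := boolP (odd p); last first.
  have p2 : p = 2 by case: (even_prime p_pr) => // odd_p; rewrite odd_p in even_p.
  subst p; left.
  have oG : (8 * n)%N = #|G| by rewrite -(Lagrange sHG) oGH oH mulnAC.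
  have oSym : #|[set: {perm Omega}]| = 24 by rewrite card_Sym oOmega.
  (* The order [8 * n] divides [4! = 24], so [n] divides 3. *)
  have n3 : n = 3.
    have : 8 * n %| 8 * 3 by rewrite oG -[(8 * 3)%N]oSym cardSg ?subsetT.
    by rewrite dvdn_pmul2l // dvdn_divisors // !inE => /orP[] /eqP n3; rewrite n3 in n_gt1 *.
  have defG : G :=: [set: {perm Omega}].
    by apply/eqP; rewrite eqEcard subsetT oSym -oG n3.
  split=> //; rewrite affine_gen_F2 defG; apply: isog_perm_card.
  by rewrite oOmega card_mx card_Fp.
right.
have p_gt2 : 2 < p by rewrite odd_prime_gt2.
(* By transitivity, a normal subgroup of [G] that fixes [w] fixes every point. *)
have core1 : gcore H G = 1.
  have nsK : gcore H G <| G := gcore_normal sHG.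
  apply/trivgP/subsetP=> k Kk; rewrite inE; apply/eqP/permP=> v; rewrite perm1.
  have [g Gg ->] : exists2 g, g \in G & v = g w.
    have : v \in orbit 'P G w by rewrite (atransP trG) ?inE.
    by case/orbitP=> g Gg <-; exists g.
  have : k ^ g^-1 \in H.
    by rewrite (subsetP (gcore_sub H G)) // memJ_norm // (subsetP (normal_norm nsK)) ?groupV.
  case/setIP=> _ /astab1P; rewrite /= apermE conjgE invgK !permM => /(canRL (permKV g)).
  by [].
have [T [_ oT abelT sdG cH1]] :=
  normal_complement p_pr odd_p sHG oGH core1 n_gt1 defH oH ox y2 xy.
have [phi0 co0] := abelem_p2_coord p_pr abelT oT.
have [n2 | n_neq2] := eqVneq n 2.
  right; right; left; split=> //.
  exact: (stab_klein p_pr odd_p sdG cH1 n_gt1 defH oH ox y2 xy co0 n2).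
have n_gt2 : 2 < n by rewrite ltn_neqAle eq_sym n_neq2.
have [phi [a [b [c [co hX hY det]]]]] :=
  stab_normal_form p_pr odd_p sdG cH1 defH ox y2 xy co0 n_gt2.
have [bc0 | bc_nz] := eqVneq (b * c)%R 0%R; last first.
  have [s /eqP bc | nsq] := pickP (fun s => b * c == s ^+ 2)%R.
    have s_nz : s != 0%R by apply: contraNneq bc_nz => s0; rewrite bc s0 expr0n.
    right; left.
    have [n_p ex_t] := stab_split p_pr odd_p sdG cH1 n_gt1 defH ox co s_nz bc det hX hY.
    by [].
  left; have [|n_p ex_ef] :=
      stab_nonsplit p_pr odd_p sdG cH1 n_gt1 defH ox gen_theta co _ det hX hY.
    by move=> s; rewrite nsq.
  by [].
have a1 : (a == 1)%R || (a == -1)%R by rewrite -sqrf_eq1 -det bc0 subr0.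
have aa : (a * a = 1)%R by rewrite -expr2; apply/eqP; rewrite sqrf_eq1.
(* If [b] and [c] both vanished, [x] would act with square 1, contrary to [n > 2]. *)
have b_or_c : (b != 0)%R || (c != 0)%R.
  rewrite -negb_and; apply: contraL n_gt2 => /andP[/eqP b0 /eqP c0]; rewrite -leqNgt.
  apply: dvdn_leq => //; rewrite (acts_by_order cH1 defH ox 2 co hX) b0 c0.
  by rewrite expr_mx2_diag expr2 aa -mx2_scalar.
right; right; right.
move: bc0 => /eqP; rewrite mulf_eq0 => /orP[] /eqP z0; rewrite z0 eqxx ?orbF /= in b_or_c;
  rewrite z0 in hX; case/orP: a1 => /eqP a1; rewrite a1 in hX.
- left; have [] := stab_lower p_pr sdG cH1 n_gt1 defH ox co b_or_c hX hY.
  by [].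
- right; left; have [] := stab_neg_lower p_pr odd_p sdG cH1 defH ox co n_gt2 b_or_c hX hY.
  by [].
- right; right; have [] := stab_upper p_pr odd_p sdG cH1 n_gt1 defH oH ox y2 xy co b_or_c hX hY.
  by [].
right; left; have [] := stab_neg_upper p_pr odd_p sdG cH1 defH ox co n_gt2 b_or_c hX hY.
by [].
Qed.
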